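(* Let $1<p<\infty$ and let $\mu,\nu_+,\nu_-$ satisfy the standing assumptions below. Then $$\lim_{\epsilon\searrow0}\epsilon^{-1/p}\,W_p(\mu+\epsilon\nu_+,\mu+\epsilon\nu_-)=\|\nu\|_\mu^{1/p}.$$
   Context: $\Omega\subset\mathbb R^k$ is a compact set equal to the closure of its interior. For nonnegative measures of equal mass, $W_p(\mu_1,\mu_2):=\big(\inf_\pi\int|x-y|^p\,d\pi\big)^{1/p}$ over nonnegative $\pi$ on $\Omega\times\Omega$ with marginals $\mu_1,\mu_2$. Strong $d$-connectedness: a nonnegative measure $\mu$ is strongly $d$-connected if there exist $L,K>0$, an integer $N\ge2$ and a measure space $(D,\beta)$ with $0<\beta(D)<\infty$ such that for any $x_0,x_1\in\mathrm{supp}(\mu)$ there are $k\le N$ points $y_1=x_0,\dots,y_k=x_1$ in $\mathrm{supp}(\mu)$ and measurable $\Phi_j:[0,1]\times D\to\mathrm{supp}(\mu)$, $j=1,\dots,k-1$, with: (i) $s\mapsto\Phi_j(s,b)$ $L$-Lipschitz for each $b$; (ii) $\Phi_j$ injective on $(0,1)\times D$, $\Phi_j(0,b)=y_j$, $\Phi_j(1,b)=y_{j+1}$; (iii) $(\Phi_j)_\#\rho\le\mu$, $\rho(ds,db)=Ks^{d-1}(1-s)^{d-1}ds\,\beta(db)$. Standing assumptions: $\mu$ is a Borel probability measure on $\Omega$ with $\mu=\sum_{j=1}^m\mu_j$, $m\ge2$, where the $\mu_j$ are nonnegative measures whose supports $A_j:=\mathrm{supp}(\mu_j)$ are pairwise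 disjoint, and each $\mu_j$ is strongly $d_j$-connected for some $d_j\ge1$. $\nu_+,\nu_-$ are nonnegative finite Borel measures with $\nu_+(\Omega)=\nu_-(\Omega)$ and $\mathrm{supp}(\nu_+)\cup\mathrm{supp}(\nu_-)\subset\mathrm{supp}(\mu)$; $\nu:=\nu_+-\nu_-$. Graph data: $\bar\nu_j:=\nu(A_j)$ (so $\sum_j\bar\nu_j=0$); $V=\{1,\dots,m\}$, $V_+=\{j:\bar\nu_j>0\}$, $V_-=\{j:\bar\nu_j<0\}$. For $i,j\in V$, $|E|_{i,j}:=\mathrm{dist}^p(A_i,A_j)=\min_{x\in A_i,y\in A_j}|x-y|^p$. For $i,j\in V$, $|\bar E|_{i,j}:=\min\sum_{l=1}^{n-1}|E|_{k_l,k_{l+1}}$, the minimum over all finite sequences $k_1=i,k_2,\dots,k_n=j$ in $V$ (geodesic distance in the complete graph on $V$ with edge lengths $|E|$). Finally $$\|\nu\|_\mu:=\min_{\lambda}\sum_{i\in V_+}\sum_{j\in V_-}\lambda_{i,j}|\bar E|_{i,j},$$ the minimum over nonnegative $|V_+|\times|V_-|$ matrices $(\lambda_{i,j})$ with $\sum_{j\in V_-}\lambda_{i,j}=\bar\nu_i$ for $i\in V_+$ and $\sum_{i\in V_+}\lambda_{i,j}=-\bar\nu_j$ for $j\in V_-$. *)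

(* Defs.v *)
From HB Require Import structures.
From mathcomp Require Import all_boot all_order all_algebra.
From mathcomp Require Import all_classical all_reals all_analysis.
Set Implicit Arguments. Unset Strict Implicit. Unset Printing Implicit Defensive.
Import Order.TTheory GRing.Theory Num.Theory.
Import numFieldNormedType.Exports.
Local Open Scope classical_set_scope.
Local Open Scope ring_scope.

Section Defs.
Variables (R : realType) (k : nat).

Definition Pt := 'rV[R]_k.

Definition eucl (x y : Pt) : R :=
  Num.sqrt (\sum_(i < k) (x ord0 i - y ord0 i) ^+ 2).

Definition BT := g_sigma_algebraType (@open Pt).

Definition supp (m : set BT -> \bar R) : set Pt :=
  [set x | forall U : set Pt, open U -> U x -> (0 < m U)%E].

Definition is_coupling (Om : set Pt) (m1 m2 : set BT -> \bar R)
    (pi : {measure set (BT * BT) -> \bar R}) : Prop :=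
  pi (~` (Om `*` Om)) = 0%E /\
  (forall A : set BT, measurable A -> pi (A `*` setT) = m1 A) /\
  (forall B : set BT, measurable B -> pi (setT `*` B) = m2 B).

Definition Wpp (p : R) (Om : set Pt) (m1 m2 : set BT -> \bar R) : \bar R :=
  ereal_inf [set c | exists pi, is_coupling Om m1 m2 pi /\
     c = (\int[pi]_z ((eucl z.1 z.2) `^ p)%:E)%E].

Definition Wp (p : R) (Om : set Pt) (m1 m2 : set BT -> \bar R) : \bar R :=
  poweR (Wpp p Om m1 m2) p^-1.

Definition I01 : set R := [set s | 0 <= s <= 1].

Definition rho (dD : measure_display) (D : measurableType dD)
    (beta : {measure set D -> \bar R}) (K d : R) (E : set (R * D)) : \bar R :=
  (\int[beta]_b \int[lebesgue_measure]_(s in [set s | I01 s /\ E (s, b)])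
      (K * s `^ (d - 1) * (1 - s) `^ (d - 1))%:E)%E.

Definition strongly_connected (d : R) (m : set BT -> \bar R) : Prop :=
  exists (L K : R) (N : nat), 0 < L /\ 0 < K /\ (2 <= N)%N /\
  exists (dD : measure_display) (D : measurableType dD)
         (beta : {measure set D -> \bar R}),
    (0 < beta setT)%E /\ (beta setT < +oo)%E /\
    forall x0 x1 : Pt, supp m x0 -> supp m x1 ->
    exists (n : nat) (y : nat -> Pt) (Phi : nat -> R * D -> BT),
      (1 <= n <= N)%N /\ y 0%N = x0 /\ y n.-1 = x1 /\
      (forall i, (i < n)%N -> supp m (y i)) /\
      forall j, (j < n.-1)%N ->
        measurable_fun (I01 `*` setT) (Phi j) /\
        (forall s b, I01 s -> supp m (Phi j (s, b))) /\
        [/\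
            (forall b s t, I01 s -> I01 t ->
               eucl (Phi j (s, b)) (Phi j (t, b)) <= L * `|s - t|),
            (forall s t b b', 0 < s < 1 -> 0 < t < 1 ->
               Phi j (s, b) = Phi j (t, b') -> s = t /\ b = b'),
            (forall b, Phi j (0, b) = y j /\ Phi j (1, b) = y j.+1) &
            (forall A : set BT, measurable A ->
               (rho beta K d (Phi j @^-1` A `&` (I01 `*` setT)) <= m A)%E)].

Definition Edist (p : R) (X Y : set Pt) : \bar R :=
  ereal_inf [set ((eucl x y) `^ p)%:E | x in X & y in Y].

Variable m : nat.

Fixpoint plen (E : 'I_m -> 'I_m -> \bar R) (i : 'I_m) (s : seq 'I_m)
    : \bar R :=
  match s with
  | [::] => 0%E
  | j :: s' => (E i j + plen E j s')%E
  end.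

Definition Ebar (E : 'I_m -> 'I_m -> \bar R) (i j : 'I_m) : \bar R :=
  ereal_inf [set plen E i s | s in [set s : seq 'I_m | last i s = j]].

Definition nunorm (nb : 'I_m -> R) (Eb : 'I_m -> 'I_m -> \bar R) : \bar R :=
  ereal_inf [set c | exists lam : 'I_m -> 'I_m -> R,
    [/\ forall i j, 0 <= lam i j,
        forall i, 0 < nb i -> \sum_(j | nb j < 0) lam i j = nb i,
        forall j, nb j < 0 -> \sum_(i | 0 < nb i) lam i j = - nb j &
        c = (\sum_(i | (0 < nb i)%R) \sum_(j | (nb j < 0)%R) (lam i j)%:E * Eb i j)%E]].

Definition nubar (mus : 'I_m -> set BT -> \bar R) (nup num : set BT -> \bar R)
    (j : 'I_m) : R :=
  fine (nup (supp (mus j))) - fine (num (supp (mus j))).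

Definition nu_norm (p : R) (mus : 'I_m -> set BT -> \bar R)
    (nup num : set BT -> \bar R) : \bar R :=
  nunorm (nubar mus nup num)
    (Ebar (fun i j => Edist p (supp (mus i)) (supp (mus j)))).

End Defs.

(* Main.v *)
Require Import Defs.
From HB Require Import structures.
From mathcomp Require Import all_boot all_order all_algebra.
From mathcomp Require Import all_classical all_reals all_analysis.
From mathcomp Require Import measurable_realfun ring lra.
Import Order.TTheory GRing.Theory Num.Theory.
Import numFieldNormedType.Exports.
Set Implicit Arguments. Unset Strict Implicit. Unset Printing Implicit Defensive.
Local Open Scope classical_set_scope.
Local Open Scope ring_scope.

(** Lower bound: the masses a coupling sends from [A_i] to [A_j] form a flow on
    [V] whose divergence is [eps * nubar]. Bypassing the vertices one at a time
    turns it into a transport plan from [V_+] to [V_-] without increasing the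
    cost, so that [Wpp >= eps * nu_norm] for every [eps > 0].

    Upper bound: the coupling is an explicit combination of product measures
    and the diagonal. Replace a point [x] of [supp mu] by the normalised
    restriction of [mu] to a small ball around [x]. A mass [eps] can be passed
    from ball to ball: what enters a ball and what leaves it differ only by a
    multiple [eps] of a measure dominated by [mu], which the diagonal part of
    the coupling absorbs, so no gluing of couplings is needed. Cutting a
    Lipschitz path of [supp mu] into [n] jumps costs [eps * n * (L / n) ^ p],
    negligible as [n] grows because [p > 1]; jumps between components cost
    [eps * |x - y| ^ p]. *)

(** * Flows on a finite complete graph *)

Section Flow.
Variables (R : realFieldType) (I : finType) (d : I -> I -> R).
Hypothesis d_triangle : forall i v j, d i j <= d i v + d v j.

(* The flow through [v] is rerouted directly from its predecessors to its
   successors, in proportion [u i * w j], until its inflow or its outflow is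
   exhausted. *)
Lemma flow_bypass (q : I -> I -> R) (v : I) : (forall i j, 0 <= q i j) ->
  exists q' : I -> I -> R, [/\ forall i j, 0 <= q' i j,
    forall i, \sum_j q' i j - \sum_j q' j i = \sum_j q i j - \sum_j q j i,
    \sum_i \sum_j q' i j * d i j <= \sum_i \sum_j q i j * d i j,
    (forall i, i != v -> q' i v = 0) \/ (forall j, j != v -> q' v j = 0) &
    forall u, ((forall i, i != u -> q i u = 0) ->
                forall i, i != u -> q' i u = 0) /\
              ((forall j, j != u -> q u j = 0) ->
                forall j, j != u -> q' u j = 0)].
Proof.
move=> q0.
(* Inflow and outflow of [v], with the loop [q v v] left out. If either is zero, the flow already
   has the required form. *)
pose a := \sum_(i | i != v) q i v; pose b := \sum_(j | j != v) q v j.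
have a0 : 0 <= a by apply: sumr_ge0.
have b0 : 0 <= b by apply: sumr_ge0.
have [az|an0] := eqVneq a 0.
  exists q; split=> //; left => i iv.
  by apply: (psumr_eq0P _ az) iv => // j _.
have [bz|bn0] := eqVneq b 0.
  exists q; split=> //; right => i iv.
  by apply: (psumr_eq0P _ bz) iv => // j _.
have {}a0 : 0 < a by rewrite lt_def an0.
have {}b0 : 0 < b by rewrite lt_def bn0.
pose u i := if i == v then 0 else q i v / a.
pose w j := if j == v then 0 else q v j / b.
have u0 i : 0 <= u i by rewrite /u; case: ifP => // _; rewrite divr_ge0// ltW.
have w0 i : 0 <= w i by rewrite /w; case: ifP => // _; rewrite divr_ge0// ltW.
have su : \sum_i u i = 1.
  rewrite (bigID (fun i => i == v)) /= big1 ?add0r; last first.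
    by move=> i /eqP ->; rewrite /u eqxx.
  rewrite (eq_bigr (fun i => q i v / a)); first by rewrite -mulr_suml divff.
  by move=> i /negPf iv; rewrite /u iv.
have sw : \sum_i w i = 1.
  rewrite (bigID (fun i => i == v)) /= big1 ?add0r; last first.
    by move=> i /eqP ->; rewrite /w eqxx.
  rewrite (eq_bigr (fun i => q v i / b)); first by rewrite -mulr_suml divff.
  by move=> i /negPf iv; rewrite /w iv.
have uv : u v = 0 by rewrite /u eqxx.
have wv : w v = 0 by rewrite /w eqxx.
pose t := Num.min a b.
have t0 : 0 < t by rewrite lt_min a0 b0.
(* Since [t <= a], the amount [t * u i] withdrawn from the edge from [i] to [v] never exceeds what
   that edge carries; this keeps the new flow nonnegative. *)
have tu i : t * u i <= (i != v)%:R * q i v.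
  rewrite /u; case: eqP => iv /=; first by rewrite mulr0 mul0r.
  rewrite mul1r mulrA ler_pdivrMr// mulrC ler_wpM2l//.
  by rewrite ge_min lexx.
have tw i : t * w i <= (i != v)%:R * q v i.
  rewrite /w; case: eqP => iv /=; first by rewrite mulr0 mul0r.
  rewrite mul1r mulrA ler_pdivrMr// mulrC ler_wpM2l//.
  by rewrite ge_min lexx orbT.
pose e (i : I) : R := (i == v)%:R.
have sume (F : I -> R) : \sum_i e i * F i = F v.
  rewrite (bigD1 v) //= /e eqxx mul1r big1 ?addr0// => i /negPf ->.
  by rewrite mul0r.
(* Each unit rerouted adds [u i * w j] on direct edges and removes [u i] on the edge into [v] and
   [w j] on the edge out of [v]. Row sums and column sums of [c] are both [- e], so divergences do
   not change. *)
pose c i j := u i * w j - u i * e j - e i * w j.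
have crow i : \sum_j c i j = - e i.
  rewrite /c !sumrB -!mulr_sumr sw mulr1.
  have -> : \sum_j e j = 1.
    by rewrite -[RHS](sume (fun=> 1)); apply: eq_bigr => j _; rewrite mulr1.
  by rewrite !mulr1 subrr sub0r.
have ccol j : \sum_i c i j = - e j.
  rewrite /c !sumrB -!mulr_suml su mul1r.
  have -> : \sum_j e j = 1.
    by rewrite -[RHS](sume (fun=> 1)); apply: eq_bigr => k _; rewrite mulr1.
  by rewrite !mul1r addrAC subrr sub0r.
exists (fun i j => q i j + t * c i j); split.
- move=> i j; rewrite /c /e.
  have uw : 0 <= t * (u i * w j) by rewrite mulr_ge0 ?mulr_ge0// ltW.
  have := tu i; have := tw j; have := q0 i j.
  case: eqP => [->|jv]; case: eqP => [->|iv];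
    rewrite ?uv ?wv ?(mulr0, mulr1, mul0r, mul1r, subr0, sub0r) /= => *;
    by rewrite ?(mulr0, mulrN, mul0r, oppr0, addr0) //; nra.
- move=> i; rewrite !big_split /= -!mulr_sumr crow ccol; ring.
- under eq_bigr do under eq_bigr do rewrite mulrDl.
  under eq_bigr do rewrite big_split /=.
  rewrite big_split /= gerDl.
  (* As [u] and [w] have total mass one, the change of cost is an average of the triangle defects
     [d i j - d i v - d v j], all nonpositive. *)
  have -> : \sum_i \sum_j t * c i j * d i j =
     t * \sum_i \sum_j u i * w j * (d i j - d i v - d v j).
    under eq_bigr do under eq_bigr do rewrite -mulrA.
    under eq_bigr do rewrite -mulr_sumr.
    rewrite -mulr_sumr; congr (_ * _).
    rewrite /c.
    transitivity (\sum_i \sum_j u i * w j * d i j - \sum_i u i * d i v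
                  - \sum_j w j * d v j).
      rewrite -(sume (fun i => \sum_j w j * d i j)) -!sumrB; apply: eq_bigr => i _.
      rewrite -[d i v](sume (fun j => d i j)) !mulr_sumr -!sumrB.
      apply: eq_bigr => j _; ring.
    rewrite -[X in _ - X]mul1r -su mulr_suml -!sumrB; apply: eq_bigr => i _.
    rewrite -[u i * d i v]mulr1 -sw !mulr_sumr -!sumrB; apply: eq_bigr => j _; ring.
  rewrite pmulr_rle0//; apply: sumr_le0 => i _; apply: sumr_le0 => j _.
  rewrite mulr_ge0_le0 ?mulr_ge0//.
  have := d_triangle i v j; lra.
(* The choice of [t] as a minimum empties one side of [v]: the inflow if [t = a], the outflow if
   [t = b]. *)
- have [tE|tE] : t = a \/ t = b.
    by rewrite /t; case: (leP a b) => _; [left|right].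
  + left => i /negPf iv.
    rewrite /c wv /e eqxx iv /u iv tE /= mul0r mulr0 mulr1 subr0 sub0r.
    by rewrite mulrN mulrC divfK ?subrr.
  + right => i /negPf iv.
    rewrite /c uv /e eqxx iv /w iv tE /= !mul0r mul1r subrr sub0r.
    by rewrite mulrN mulrC divfK ?subrr.
(* Rerouting creates no flow into a vertex that had no inflow, nor out of one that had no outflow:
   the corresponding entries of [c] vanish. Vertices treated earlier thus stay treated. *)
- move=> k; split => H i /[dup] ik; rewrite eq_sym => ki.
  + rewrite (H _ ik) add0r; suff -> : c i k = 0 by rewrite mulr0.
    rewrite /c /e; have [kv|kv] := eqVneq k v.
      by rewrite -kv (negPf ik) /u -kv (negPf ik) (H _ ik) kv wv !(mul0r, mulr0) !subr0.
    by rewrite /w (negPf kv) H 1?eq_sym// !(mul0r, mulr0) !subr0.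
  + rewrite (H _ ik) add0r; suff -> : c k i = 0 by rewrite mulr0.
    rewrite /c /e; have [kv|kv] := eqVneq k v.
      by rewrite -kv (negPf ik) /w -kv (negPf ik) (H _ ik) kv uv !(mul0r, mulr0) !subr0.
    by rewrite /u (negPf kv) H 1?eq_sym// !(mul0r, mulr0) !subr0.
Qed.

(** Bypass the vertices in turn; the last clause of [flow_bypass] keeps what earlier rounds
    achieved. Loops are ignored throughout, as they do not affect the divergence. *)
Lemma flow_sources_to_sinks (q : I -> I -> R) : (forall i j, 0 <= q i j) ->
  exists q' : I -> I -> R, [/\ forall i j, 0 <= q' i j,
    forall i, \sum_j q' i j - \sum_j q' j i = \sum_j q i j - \sum_j q j i,
    \sum_i \sum_j q' i j * d i j <= \sum_i \sum_j q i j * d i j &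
    forall v, (forall i, i != v -> q' i v = 0) \/
              (forall j, j != v -> q' v j = 0)].
Proof.
move=> q0.
suff [q' [H1 H2 H3 H4]] : exists q' : I -> I -> R, [/\ forall i j, 0 <= q' i j,
    forall i, \sum_j q' i j - \sum_j q' j i = \sum_j q i j - \sum_j q j i,
    \sum_i \sum_j q' i j * d i j <= \sum_i \sum_j q i j * d i j &
    forall v, v \in enum I -> (forall i, i != v -> q' i v = 0) \/
              (forall j, j != v -> q' v j = 0)].
  by exists q'; split=> // v; apply: H4; rewrite mem_enum.
elim: (enum I) => [|v s [q1 [q1_0 q1div q1cost q1s]]]; first by exists q; split.
have [q2 [q2_0 q2div q2cost q2v q2s]] := @flow_bypass q1 v q1_0.
exists q2; split => //.
- by move=> i; rewrite q2div q1div.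
- exact: le_trans q1cost.
- move=> w; rewrite inE => /predU1P[->//|/q1s].
  by have [Hl Hr] := q2s w; case=> [/Hl|/Hr]; [left|right].
Qed.

(** Once every vertex lacks inflow or outflow, the sign of [b] decides which: a vertex with
    [0 <= b i] and no outflow has inflow [- b i <= 0], hence none either. The off-diagonal flow
    therefore runs only from positive to negative vertices, and its divergence gives the
    marginals. *)
Lemma flow_to_transport (q : I -> I -> R) (b : I -> R) :
  (forall i j, 0 <= d i j) -> (forall i j, 0 <= q i j) ->
  (forall i, \sum_j q i j - \sum_j q j i = b i) ->
  exists l : I -> I -> R, [/\ forall i j, 0 <= l i j,
    forall i, 0 < b i -> \sum_(j | b j < 0) l i j = b i,
    forall j, b j < 0 -> \sum_(i | 0 < b i) l i j = - b j &
    \sum_(i | 0 < b i) \sum_(j | b j < 0) l i j * d i j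
      <= \sum_i \sum_j q i j * d i j].
Proof.
move=> d0 q0 qb.
have [l [l0 ldiv lcost lv]] := flow_sources_to_sinks q0.
have {}ldiv i : \sum_(j | j != i) l i j - \sum_(j | j != i) l j i = b i.
  rewrite -qb -ldiv [X in _ = X - _](bigD1 i)// [X in _ = _ - X](bigD1 i)//=; ring.
have lin i : 0 <= b i -> forall j, j != i -> l j i = 0.
  move=> bi; have [//|out] := lv i.
  have := ldiv i; rewrite big1 ?sub0r; last by move=> j; exact: out.
  move=> E; have {}E : \sum_(j | j != i) l j i = 0.
    by apply/eqP; rewrite eq_le sumr_ge0// andbT -oppr_ge0 E.
  by move=> j ji; apply: (psumr_eq0P _ E) ji.
have lout i : b i <= 0 -> forall j, j != i -> l i j = 0.
  move=> bi; have [inn|//] := lv i.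
  have := ldiv i; rewrite [X in _ - X]big1 ?subr0; last by move=> j; exact: inn.
  move=> E; have {}E : \sum_(j | j != i) l i j = 0.
    by apply/eqP; rewrite eq_le sumr_ge0// andbT E.
  by move=> j ji; apply: (psumr_eq0P _ E) ji.
exists l; split=> //.
- move=> i bi; rewrite -[RHS]ldiv [X in _ - X]big1 ?subr0; last first.
    by move=> j; apply: lin; apply: ltW.
  rewrite [RHS](bigID (fun j => b j < 0)) /= [X in _ = _ + X]big1 ?addr0.
    apply: eq_bigl => j; case: eqVneq => [->|]//=.
    by apply: contraTF bi; rewrite -leNgt; exact: ltW.
  by move=> j /andP[ji]; rewrite -leNgt => bj; rewrite lin// eq_sym.
- move=> j bj; rewrite -[b j]ldiv [X in X - _]big1 ?sub0r ?opprK; last first.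
    by move=> i; apply: lout; apply: ltW.
  rewrite [RHS](bigID (fun i => 0 < b i)) /= [X in _ = _ + X]big1 ?addr0.
    apply: eq_bigl => i; case: eqVneq => [->|]//=.
    by apply: contraTF bj; rewrite -leNgt; exact: ltW.
  by move=> i /andP[ij]; rewrite -leNgt => bi; rewrite lout// eq_sym.
- apply: le_trans lcost.
  rewrite [leRHS](bigID (fun i => 0 < b i)) /=.
  apply: ler_wpDr; first by apply: sumr_ge0 => i _; apply: sumr_ge0 => j _; apply: mulr_ge0.
  apply: ler_sum => i _; rewrite [leRHS](bigID (fun j => b j < 0)) /=.
  by apply: ler_wpDr => //; apply: sumr_ge0 => j _; apply: mulr_ge0.
Qed.

End Flow.

(** * Borel measures on Euclidean space *)

(** Restricting [m2] to [setT] turns the finiteness hypothesis into a finite measure, as the product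
    construction asks of its second factor. *)
Lemma product_measure_exists d1 d2 (T1 : measurableType d1) (T2 : measurableType d2)
  (R : realType) (m1 : {measure set T1 -> \bar R}) (m2 : {measure set T2 -> \bar R}) :
  (m2 setT < +oo)%E ->
  exists m : {measure set (T1 * T2) -> \bar R}, forall A B,
    measurable A -> measurable B -> m (A `*` B) = (m1 A * m2 B)%E.
Proof.
move=> m2fin.
exists (m1 \x mfrestr measurableT m2fin)%E => A B mA mB.
apply: etrans; first exact: product_measure1E.
by rewrite /= /mfrestr /mrestr setIT.
Qed.
Lemma measure_partition d (T : measurableType d) (R : realType) n
    (m : {measure set T -> \bar R}) (F : 'I_n -> set T) (A : set T) :
  (forall i, measurable (F i)) -> (forall i j, i != j -> F i `&` F j = set0) ->
  m (~` \big[setU/set0]_i F i) = 0%E -> measurable A ->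
  m A = (\sum_(i < n) m (A `&` F i))%E.
Proof.
move=> mF dF m0 mA.
have mU : measurable (\big[setU/set0]_(i < n) F i) by exact: bigsetU_measurable.
rewrite (measureDI m mA mU) [X in (X + _)%E](_ : _ = 0%E) ?add0e.
  rewrite big_distrr /= measure_bigsetU_ord//.
    by move=> i; exact: measurableI.
  apply/trivIsetP => i j _ _ ij.
  by rewrite setIACA dF// setI0.
apply/eqP; rewrite eq_le measure_ge0 andbT -m0 le_measure// ?inE.
- exact: measurableD.
- exact: measurableC.
Qed.

Section EuclideanSpace.
Context (R : realType) (k : nat).

Lemma coord_measurable (i : 'I_k) : measurable_fun setT (fun x : BT R k => x ord0 i).
Proof.
apply: (measurability _ (RGenOpens.measurableE R)) => _ [_ [a [b ->] <-]].
rewrite setTI; apply: sub_sigma_algebra => /=.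
have /continuousP := @coord_continuous R 1 k ord0 i; apply.
exact: interval_open.
Qed.

(** Argued through coordinates, because the sigma-algebra on pairs is the product one, generated by
    rectangles, rather than the Borel one of the product topology. *)
Lemma eucl_measurable (p : R) : measurable_fun setT
  (fun z : BT R k * BT R k => (eucl z.1 z.2 `^ p)%:E).
Proof.
apply/measurable_EFinP.
apply: (@measurableT_comp _ _ _ _ _ _ (fun x : R => x `^ p)) => //.
apply: (@measurableT_comp _ _ _ _ _ _ (@Num.sqrt R) _
    (fun z : BT R k * BT R k => \sum_(i < k) (z.1 ord0 i - z.2 ord0 i) ^+ 2)).
  by apply: continuous_measurable_fun; exact: sqrt_continuous.
apply: measurable_sum => i.
apply: (@measurableT_comp _ _ _ _ _ _ (fun x : R => x ^+ 2)) => //.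
apply: measurable_funB.
  exact: (measurableT_comp (coord_measurable i) measurable_fst).
exact: (measurableT_comp (coord_measurable i) measurable_snd).
Qed.

Lemma eucl_continuous : continuous (fun z : Pt R k * Pt R k => eucl z.1 z.2).
Proof.
move=> z; rewrite /eucl.
apply: (@continuous_comp _ _ _
    (fun z : Pt R k * Pt R k => \sum_(i < k) (z.1 ord0 i - z.2 ord0 i) ^+ 2)
    Num.sqrt); last exact: sqrt_continuous.
move: z; apply: continuous_big => [|i _ z]; first exact: add_continuous.
apply: (@continuous_comp _ _ _
    (fun z : Pt R k * Pt R k => z.1 ord0 i - z.2 ord0 i)
    (fun x : R => x ^+ 2)); last exact: exprn_continuous.
apply: continuousB.
  by apply: (@continuous_comp _ _ _ fst (fun x : Pt R k => x ord0 i));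
    [exact: cvg_fst|exact: coord_continuous].
by apply: (@continuous_comp _ _ _ snd (fun x : Pt R k => x ord0 i));
  [exact: cvg_snd|exact: coord_continuous].
Qed.

(** Bounds the cost of any coupling of two measures carried by small balls around [x] and [y]. With
    [c] the [p]-th root of the enlarged cost, [eucl < c] is an open condition satisfied at
    [(x, y)]. *)
Lemma cost_near (p : R) (x y : Pt R k) (e : R) : 0 < p -> 0 < e ->
  \forall r \near 0^'+, forall x' y', ball x r x' -> ball y r y' ->
    eucl x' y' `^ p <= eucl x y `^ p + e.
Proof.
move=> p0 e0; pose c := (eucl x y `^ p + e) `^ p^-1.
have p1 : p^-1 != 0 by rewrite invr_neq0// gt_eqF.
have eucl0 (u v : Pt R k) : 0 <= eucl u v by exact: sqrtr_ge0.
have cp : c `^ p = eucl x y `^ p + e.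
  by rewrite -powRrM mulVf ?gt_eqF// powRr1// addr_ge0 ?powR_ge0// ltW.
have xyc : eucl x y < c.
  rewrite ltNge; apply/negP => /(ge0_ler_powR (ltW p0)).
  rewrite !nnegrE powR_ge0 => /(_ isT (eucl0 _ _)).
  by rewrite cp; apply/negP; rewrite -ltNge ltrDl.
have /nbhs_ballP[/= r0 r0_gt0 H] : nbhs (x, y) [set z : Pt R k * Pt R k | eucl z.1 z.2 < c].
  have := @eucl_continuous (x, y) [set t | t < c]; apply.
  by apply: open_nbhs_nbhs; split; [exact: open_lt|].
near=> r => x' y' xx' yy'.
rewrite -cp ge0_ler_powR ?nnegrE ?powR_ge0 ?(ltW p0) ?eucl0//.
have rr0 : r <= r0 by near: r; exact: nbhs_right_le.
apply/ltW; apply: (H (x', y')).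
by split; apply: le_ball rr0 _ _.
Unshelve. all: by end_near. Qed.

(** Finite subcovers packaged as an induction principle: a property of sets that is local,
    hereditary and stable under finite unions passes to compact sets. *)
Lemma compact_ind (K : set (Pt R k)) (P : set (Pt R k) -> Prop) : compact K ->
  P set0 -> (forall A B, A `<=` B -> P B -> P A) ->
  (forall A B, P A -> P B -> P (A `|` B)) ->
  (forall x, K x -> exists2 U, open U /\ U x & P U) -> P K.
Proof.
move=> cK P0 PS PU PK.
have HV x : exists V : set (Pt R k), K x -> [/\ open V, V x & P V].
  have [Kx|nKx] := pselect (K x); last by exists set0.
  by have [V [oV Vx] PV] := PK x Kx; exists V.
have [U HU] := choice HV.
move: cK; rewrite compact_cover => /(_ _ K U).
case=> [x /HU[]//|x Kx|D DK KD]; first by exists x => //; have [] := HU x Kx.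
apply: (PS _ _ KD); rewrite /cover.
rewrite bigcup_fset.
have : {subset finmap.enum_fset D <= K} by [].
elim: (finmap.enum_fset D) => [|a s IH] sK; first by rewrite big_nil.
rewrite big_cons; apply: PU.
  by have [] := HU a (set_mem (sK a (mem_head _ _))).
by apply: IH => b bs; apply: sK; rewrite inE bs orbT.
Qed.

Lemma BT_open_measurable (U : set (BT R k)) : open (U : set (Pt R k)) -> measurable U.
Proof. by move=> oU; apply: sub_sigma_algebra. Qed.

Lemma BT_closed_measurable (U : set (BT R k)) : closed (U : set (Pt R k)) -> measurable U.
Proof.
move=> cU; rewrite -[U]setCK; apply: measurableC.
by apply: BT_open_measurable; exact: closed_openC.
Qed.

(** * Supports of Borel measures *)

Section Support.
Variable m : {measure set (BT R k) -> \bar R}.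

Lemma supp_closed : closed (supp m).
Proof.
move=> x clx U oU Ux.
have [y [my Uy]] := clx U (open_nbhs_nbhs (conj oU Ux)).
exact: my.
Qed.

Lemma supp_measurable : measurable (supp m : set (BT R k)).
Proof. exact: BT_closed_measurable supp_closed. Qed.

Lemma suppPn (x : Pt R k) : ~ supp m x ->
  exists U : set (Pt R k), [/\ open U, U x & m U = 0%E].
Proof.
move=> /existsNP[U] /not_implyP[oU] /not_implyP[Ux /negP].
by rewrite -leNgt => mU; exists U; split=> //; apply/eqP; rewrite eq_le mU measure_ge0.
Qed.

Lemma supp_subset (F : set (Pt R k)) : closed F -> m (~` F) = 0%E -> supp m `<=` F.
Proof.
move=> cF mF x mx; apply: contrapT => nFx.
by have := mx (~` F) (closed_openC cF) nFx; rewrite mF ltxx.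
Qed.

(** The part of [Om] off the support is a countable union of compact sets [Kn n], those points at
    distance at least [1 / (n + 1)] from the support. Each [Kn n] is covered by finitely many null
    open sets. *)
Lemma supp_null (Om : set (Pt R k)) : compact Om -> closed Om ->
  m (~` Om) = 0%E -> m (~` supp m) = 0%E.
Proof.
move=> cOm clOm mOm.
pose W n := \bigcup_(y in supp m) ball y (n.+1%:R^-1 : R).
pose Kn n := Om `&` ~` W n.
have clK n : closed (Kn n).
  apply: closedI => //; apply: open_closedC; apply: bigcup_open => y _.
  exact: ball_open.
have mK n : m (Kn n) = 0%E.
  (* Asking for a null measurable superset makes the property hereditary, even for subsets that are
     not measurable. *)
  have : exists A : set (BT R k), [/\ measurable A, Kn n `<=` A & m A = 0%E].
    apply: (@compact_ind (Kn n) (fun B => exists A : set (BT R k),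
        [/\ measurable A, B `<=` A & m A = 0%E])).
    - by apply: subclosed_compact cOm _ => //; exact: subIsetl.
    - by exists set0; split=> //; rewrite measure0.
    - by move=> A B AB [C [mC BC C0]]; exists C; split=> //; exact: subset_trans BC.
    - move=> A B [A' [mA' AA' A0]] [B' [mB' BB' B0]]; exists (A' `|` B'); split.
      + exact: measurableU.
      + exact: setUSS.
      + by apply/eqP; rewrite eq_le measure_ge0 andbT -(adde0 0%E) -{1}A0 -B0 measureU2.
    - move=> x [_ Wx]; have [|U [oU Ux mU]] := @suppPn x.
        by move=> sx; apply: Wx; exists x => //; exact: ballxx.
      by exists U => //; exists U; split=> //; exact: BT_open_measurable.
  move=> [A [mA KA A0]]; apply/eqP; rewrite eq_le measure_ge0 andbT -A0.
  by rewrite le_measure// inE//; exact: BT_closed_measurable.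
apply/eqP; rewrite eq_le measure_ge0 andbT.
have HT : ~` supp m `<=` ~` Om `|` \bigcup_n Kn n.
  move=> x nx; have [Omx|] := pselect (Om x); last by left.
  right; have : nbhs x (~` supp m).
    by apply: open_nbhs_nbhs; split=> //; exact: closed_openC supp_closed.
  move=> /nbhs_ballP[e /= e0 He].
  near \oo => n.
  exists n => //; split=> // -[y sy yx].
  apply: (He y) => //; apply: ball_sym; apply: le_ball yx; apply: ltW.
  by near: n; exact: near_infty_natSinv_lt (PosNum e0).
have mKn n : measurable (Kn n : set (BT R k)) by exact: BT_closed_measurable.
have mOmC : measurable (~` Om : set (BT R k)).
  by apply: measurableC; exact: BT_closed_measurable.
have mUK : measurable (\bigcup_n Kn n : set (BT R k)) by exact: bigcup_measurable.
apply: (@le_trans _ _ (m (~` Om `|` \bigcup_n Kn n))).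
  rewrite le_measure// inE; last exact: measurableU.
  by apply: measurableC; exact: supp_measurable.
apply: le_trans (measureU2 _ mOmC mUK) _.
rewrite [X in (X + _)%E](_ : _ = 0%E) ?add0e; last exact: mOm.
apply: le_trans (measure_sigma_subadditive _ mKn mUK (@subset_refl _ _)) _.
by rewrite eseries0// => n _ _; rewrite mK.
Unshelve. all: by end_near. Qed.

End Support.

End EuclideanSpace.

(** * Transport modulo measures dominated by [mu] *)

Lemma pushforward_measure d1 d2 (T1 : measurableType d1) (T2 : measurableType d2)
    (R : realType) (mu : {measure set T1 -> \bar R}) (f : T1 -> T2) :
  measurable_fun setT f -> exists m : {measure set T2 -> \bar R},
    (forall A, m A = mu (f @^-1` A)) /\
    (forall g : T2 -> \bar R, measurable_fun setT g -> (forall y, 0 <= g y)%E ->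
      (\int[m]_y g y = \int[mu]_x g (f x))%E).
Proof.
move=> mf; unshelve eexists (pushforward mu f); first exact: mf.
by split=> // g mg g0; rewrite ge0_integral_pushforward.
Qed.

Section Reach.
Variables (R : realType) (k : nat) (p : R) (mu : {measure set (BT R k) -> \bar R}).

Definition cost (z : BT R k * BT R k) : \bar R := (eucl z.1 z.2 `^ p)%:E.

Lemma cost_ge0 z : (0 <= cost z)%E. Proof. by rewrite lee_fin powR_ge0. Qed.

Lemma measurable_cost : measurable_fun setT cost. Proof. exact: eucl_measurable. Qed.

(* [s <= C * mu]; carrying the complement [s2 = C * mu - s] avoids subtracting
   measures. *)
Definition dominated (s : set (BT R k) -> \bar R) : Prop :=
  exists (s1 s2 : {measure set (BT R k) -> \bar R}) (C : R), 0 <= C /\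
    forall A, measurable A -> s1 A = s A /\ (s A + s2 A = C%:E * mu A)%E.

(* [s] is the intermediate stock of a transport of [al] to [be]: since [s] is
   dominated, [eps * s] can be borrowed from [mu] for small [eps]. *)
Definition reach (al be : set (BT R k) -> \bar R) (c : R) : Prop :=
  exists (pi : {measure set (BT R k * BT R k) -> \bar R})
         (s : set (BT R k) -> \bar R),
    [/\ dominated s,
        forall A, measurable A -> pi (A `*` setT) = (al A + s A)%E,
        forall A, measurable A -> pi (setT `*` A) = (be A + s A)%E &
        (\int[pi]_z cost z <= c%:E)%E].

Hypothesis mu_fin : (mu setT < +oo)%E.

Lemma mu_fin_num A : measurable A -> mu A \is a fin_num.
Proof. by move=> mA; apply: lty_fin_num_fun. Qed.

Lemma dominated_fin s A : dominated s -> measurable A -> s A \is a fin_num.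
Proof.
move=> [s1 [s2 [C [C0 H]]]] mA; have [_ sA] := H A mA.
have : (s A + s2 A)%E \is a fin_num by rewrite sA fin_numM// mu_fin_num.
by rewrite fin_numD => /andP[].
Qed.

Lemma dominated_ge0 s A : dominated s -> measurable A -> (0 <= s A)%E.
Proof. by move=> [s1 [s2 [C [C0 H]]]] mA; have [<- _] := H A mA. Qed.

Lemma dominated_ext s t : (forall A, measurable A -> s A = t A) ->
  dominated s -> dominated t.
Proof.
move=> st [s1 [s2 [C [C0 H]]]]; exists s1, s2, C; split=> // A mA.
by rewrite -st//; exact: H.
Qed.

Lemma dominated0 : dominated (fun=> 0%E).
Proof. by exists mzero, mzero, 0; split=> // A mA; rewrite /mzero/= mul0e add0e. Qed.

Lemma dominatedD s t : dominated s -> dominated t ->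
  dominated (fun A => s A + t A)%E.
Proof.
move=> [s1 [s2 [C [C0 H]]]] [t1 [t2 [C' [C'0 H']]]].
exists (measure_add s1 t1), (measure_add s2 t2), (C + C'); split.
  exact: addr_ge0.
move=> A mA; have [e eC] := H A mA; have [e' eC'] := H' A mA.
split; first by rewrite -e -e' -measure_addE.
rewrite [X in (_ + X)%E](measure_addE s2 t2).
by rewrite addeACA eC eC' EFinD ge0_muleDl ?lee_fin.
Qed.

Lemma dominatedZ a s : 0 <= a -> dominated s -> dominated (fun A => a%:E * s A)%E.
Proof.
move=> a0 [s1 [s2 [C [C0 H]]]].
exists (mscale (NngNum a0) s1), (mscale (NngNum a0) s2), (a * C); split.
  exact: mulr_ge0.
move=> A mA; have [es eC] := H A mA; split; first by rewrite -es.
rewrite [X in (_ + X)%E](_ : _ = a%:E * s2 A)%E// EFinM -muleA -eC.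
by rewrite ge0_muleDr// -es.
Qed.

Lemma dominated_sum (I : Type) (r : seq I) (P : pred I) (s : I -> set (BT R k) -> \bar R) :
  (forall i, P i -> dominated (s i)) ->
  dominated (fun A => \sum_(i <- r | P i) s i A)%E.
Proof.
move=> ds; elim: r => [|i r IH].
  by apply: dominated_ext dominated0 => A _; rewrite big_nil.
have [Pi|nPi] := boolP (P i).
  apply: dominated_ext (dominatedD (ds i Pi) IH) => A _.
  by rewrite big_cons Pi.
by apply: dominated_ext IH => A _; rewrite big_cons (negPf nPi).
Qed.

Lemma reach_ext al al' be be' c :
  (forall A, measurable A -> al A = al' A) ->
  (forall A, measurable A -> be A = be' A) ->
  reach al be c -> reach al' be' c.
Proof.
move=> eal ebe [pi [s [ds H1 H2 H3]]]; exists pi, s; split=> // A mA.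
  by rewrite -eal// H1.
by rewrite -ebe// H2.
Qed.

Lemma reach_le al be c c' : c <= c' -> reach al be c -> reach al be c'.
Proof.
move=> cc [pi [s [ds H1 H2 H3]]]; exists pi, s; split=> //.
by apply: le_trans H3 _; rewrite lee_fin.
Qed.

Lemma reach0 : reach (fun=> 0%E) (fun=> 0%E) 0.
Proof.
exists mzero, (fun=> 0%E); split=> [|A mA|A mA|]; rewrite /mzero/= ?adde0//.
  exact: dominated0.
by rewrite integral_measure_zero.
Qed.

Lemma reachD al be c al' be' c' : reach al be c -> reach al' be' c' ->
  reach (fun A => al A + al' A)%E (fun A => be A + be' A)%E (c + c').
Proof.
move=> [pi [s [ds H1 H2 H3]]] [pi' [s' [ds' H1' H2' H3']]].
exists (measure_add pi pi'), (fun A => s A + s' A)%E; split.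
- exact: dominatedD.
- by move=> A mA; rewrite [LHS]measure_addE H1// H1'// addeACA.
- by move=> A mA; rewrite [LHS]measure_addE H2// H2'// addeACA.
- rewrite ge0_integral_measure_add//=.
  + by rewrite EFinD leeD.
  + by move=> z _; exact: cost_ge0.
  + exact: measurable_cost.
Qed.

Lemma reachZ a al be c : 0 <= a -> reach al be c ->
  reach (fun A => a%:E * al A)%E (fun A => a%:E * be A)%E (a * c).
Proof.
move=> a0 [pi [s [ds H1 H2 H3]]].
exists (mscale (NngNum a0) pi), (fun A => a%:E * s A)%E; split.
- exact: dominatedZ.
- move=> A mA; rewrite [LHS](_ : _ = a%:E * pi (A `*` setT))%E// H1//.
  rewrite muleDr// fin_num_adde_defl//.
  exact: dominated_fin.
- move=> A mA; rewrite [LHS](_ : _ = a%:E * pi (setT `*` A))%E// H2//.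
  rewrite muleDr// fin_num_adde_defl//.
  exact: dominated_fin.
- rewrite ge0_integral_mscale//=.
  + by rewrite EFinM lee_wpmul2l ?lee_fin.
  + exact: measurable_cost.
  + by move=> z _; exact: cost_ge0.
Qed.

Lemma reach_sum (I : Type) (r : seq I) (P : pred I)
    (al be : I -> set (BT R k) -> \bar R) (c : I -> R) :
  (forall i, P i -> reach (al i) (be i) (c i)) ->
  reach (fun A => \sum_(i <- r | P i) al i A)%E
        (fun A => \sum_(i <- r | P i) be i A)%E (\sum_(i <- r | P i) c i).
Proof.
move=> H; elim: r => [|i r IH].
  by rewrite big_nil; apply: reach_ext reach0 => A _; rewrite big_nil.
rewrite big_cons; have [Pi|nPi] := boolP (P i).
  by apply: reach_ext (reachD (H i Pi) IH) => A _; rewrite big_cons Pi.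
by apply: reach_ext IH => A _; rewrite big_cons (negPf nPi).
Qed.

(** A dominated part common to source and target counts as stock: the same [pi] serves, with [g]
    added to [s]. *)
Lemma reach_cancel g al be c : dominated g ->
  reach (fun A => al A + g A)%E (fun A => be A + g A)%E c -> reach al be c.
Proof.
move=> dg [pi [s [ds H1 H2 H3]]]; exists pi, (fun A => g A + s A)%E; split=> //.
- exact: dominatedD.
- by move=> A mA; rewrite H1// addeA.
- by move=> A mA; rewrite H2// addeA.
Qed.

(** Run both transports side by side and cancel [be], which occurs in the total source and in the
    total target. *)
Lemma reach_trans be al ga c c' : dominated be ->
  reach al be c -> reach be ga c' -> reach al ga (c + c').
Proof.
move=> db r1 r2; apply: (reach_cancel db).
by apply: reach_ext (reachD r1 r2) => A _ //; rewrite addeC.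
Qed.

Lemma eucl_sym (x y : Pt R k) : eucl x y = eucl y x.
Proof.
by rewrite /eucl; congr Num.sqrt; apply: eq_bigr => i _; rewrite -sqrrN opprB.
Qed.

Lemma eucl_refl (x : Pt R k) : eucl x x = 0.
Proof.
by rewrite /eucl big1 ?sqrtr0// => i _; rewrite subrr expr0n.
Qed.

Lemma reach_sym al be c : reach al be c -> reach be al c.
Proof.
move=> [pi [s [ds H1 H2 H3]]].
have ms : measurable_fun setT (fun z : BT R k * BT R k => (z.2, z.1)).
  by apply: measurable_fun_pair; [exact: measurable_snd|exact: measurable_fst].
have [m [mE mint]] := pushforward_measure pi ms.
exists m, s; split=> //.
- by move=> A mA; rewrite mE -H2//; congr (pi _); apply/seteqP; split => -[x y] [].
- by move=> A mA; rewrite mE -H1//; congr (pi _); apply/seteqP; split => -[x y] [].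
- rewrite mint; [|exact: measurable_cost|exact: cost_ge0].
  by under eq_integral do rewrite /cost/= eucl_sym.
Qed.

Lemma integral_cost_le (m : {measure set (BT R k * BT R k) -> \bar R}) W (c : R) :
  0 <= c -> measurable W -> m (~` W) = 0%E ->
  (forall z, W z -> (cost z <= c%:E)%E) ->
  (\int[m]_z cost z <= c%:E * m setT)%E.
Proof.
move=> c0 mW mW0 H.
rewrite (@ge0_negligible_integral _ _ _ _ setT (~` W))//; last first.
- by move=> z _; exact: cost_ge0.
- exact: measurable_cost.
- exact: measurableC.
rewrite setTD setCK.
apply: (@le_trans _ _ (\int[m]_(z in W) (cst c%:E) z)%E).
  apply: ge0_le_integral => //.
  - by move=> z _; exact: cost_ge0.
  - by apply: measurable_funTS; exact: measurable_cost.
rewrite integral_cst// lee_wpmul2l ?lee_fin// le_measure// inE//.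
Qed.

(** The normalised product of [al] and [be] is a coupling with empty stock, carried by the rectangle
    on which the cost is at most [c]. *)
Lemma reach_prod (al be : {measure set (BT R k) -> \bar R}) U V (c : R) :
  (al setT < +oo)%E -> al setT = be setT ->
  measurable U -> measurable V -> al (~` U) = 0%E -> be (~` V) = 0%E ->
  0 <= c -> (forall x y, U x -> V y -> eucl x y `^ p <= c) ->
  reach al be (c * fine (al setT)).
Proof.
move=> alfin albe mU mV alU beV c0 H.
have befin : (be setT < +oo)%E by rewrite -albe.
have [m mE] := product_measure_exists al befin.
pose M := fine (al setT).
have ME : al setT = M%:E by rewrite fineK// ge0_fin_numE.
have M0 : 0 <= M by rewrite fine_ge0.
have Mi0 : 0 <= M^-1 by rewrite invr_ge0.
(* When [M = 0] the inverse is [0] by convention; the identity survives because [al] then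
   vanishes. *)
have alM A : measurable A -> (M^-1%:E * (al A * M%:E) = al A)%E.
  move=> mA; have [M_0|Mn0] := eqVneq M 0.
    have : (al A <= al setT)%E by apply: le_measure; rewrite ?inE.
    rewrite ME M_0 mule0 mule0 => le0.
    by apply/eqP; rewrite eq_sym eq_le le0 measure_ge0.
  by rewrite muleC -muleA -EFinM divff// mule1.
have beM A : measurable A -> (M^-1%:E * (M%:E * be A) = be A)%E.
  move=> mA; have [M_0|Mn0] := eqVneq M 0.
    have : (be A <= be setT)%E by apply: le_measure; rewrite ?inE.
    rewrite -albe ME M_0 mul0e mule0 => le0.
    by apply/eqP; rewrite eq_sym eq_le le0 measure_ge0.
  by rewrite muleA -EFinM mulVf// mul1e.
pose m' : {measure set (BT R k * BT R k) -> \bar R} := mscale (NngNum Mi0) m.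
exists m', (fun=> 0%E); split.
- exact: dominated0.
- move=> A mA; rewrite [LHS](_ : _ = (M^-1)%:E * m (A `*` setT))%E//.
  by rewrite mE// -albe ME adde0 alM.
- move=> A mA; rewrite [LHS](_ : _ = (M^-1)%:E * m (setT `*` A))%E//.
  by rewrite mE// ME adde0 beM.
- have mUV : m (~` (U `*` V)) = 0%E.
    apply/eqP; rewrite eq_le measure_ge0 andbT.
    have mUC : measurable (~` U) by exact: measurableC.
    have mVC : measurable (~` V) by exact: measurableC.
    apply: (@le_trans _ _ (m ((~` U) `*` setT `|` setT `*` (~` V)))).
      rewrite le_measure ?inE//.
      + by apply: measurableC; exact: measurableX.
      + by apply: measurableU; exact: measurableX.
      + move=> [x y] /= nUV; have [Ux|nUx] := pselect (U x); last by left.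
        by right; split=> // Vy; apply: nUV.
    apply: le_trans (measureU2 _ (measurableX mUC measurableT)
      (measurableX measurableT mVC)) _.
    have := mE _ _ mUC measurableT; rewrite [al _]alU mul0e => e1.
    have := mE _ _ measurableT mVC; rewrite [be _]beV mule0 => e2.
    by rewrite [X in (X + _)%E]e1 [X in (_ + X)%E]e2 adde0.
  have m'UV : m' (~` (U `*` V)) = 0%E.
    by rewrite [LHS](_ : _ = (M^-1)%:E * m (~` (U `*` V)))%E// mUV mule0.
  have Hz z : (U `*` V) z -> (cost z <= c%:E)%E.
    by case: z => x y [/= Ux Vy]; rewrite lee_fin; exact: H.
  apply: le_trans (integral_cost_le c0 (measurableX mU mV) m'UV Hz) _.
  rewrite EFinM lee_wpmul2l ?lee_fin// [X in (X <= _)%E](_ : _ = (M^-1)%:E * m setT)%E//.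
  rewrite -setXTT mE// -albe -/M.
  by rewrite [X in (_ * (_ * X))%E]ME alM// ME.
Qed.

End Reach.

(** * Transport between small balls of the support *)

Section Conn.
Variables (R : realType) (k : nat) (p : R) (mu : {measure set (BT R k) -> \bar R}).
Hypothesis p1 : 1 < p.
Hypothesis mu_fin : (mu setT < +oo)%E.

Let p0 : 0 < p. Proof. by apply: lt_trans p1. Qed.

(* Zero when the ball is [mu]-null. *)
Definition smear (r : R) (x : Pt R k) (A : set (BT R k)) : \bar R :=
  (((fine (mu (ball x r)))^-1)%:E * mu (A `&` ball x r))%E.

Let ballM (x : Pt R k) r : measurable (ball x r : set (BT R k)).
Proof. by apply: BT_open_measurable; exact: ball_open. Qed.

Let inv0 (x : Pt R k) r : 0 <= (fine (mu (ball x r)))^-1.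
Proof. by rewrite invr_ge0 fine_ge0. Qed.

Lemma smear_measure r x : exists m : {measure set (BT R k) -> \bar R},
  forall A, m A = smear r x A.
Proof. by exists (mscale (NngNum (inv0 x r)) (mrestr mu (ballM x r))). Qed.

Lemma dominated_smear r x : dominated mu (smear r x).
Proof.
have mbC : measurable (~` (ball x r : set (BT R k))) by apply: measurableC.
(* The complementary measure is the same multiple of [mu] restricted outside the ball. *)
exists (mscale (NngNum (inv0 x r)) (mrestr mu (ballM x r))),
  (mscale (NngNum (inv0 x r)) (mrestr mu mbC)), (fine (mu (ball x r)))^-1.
split=> // A mA; split=> //.
by rewrite (measureDI mu mA (ballM x r)) ge0_muleDr// addeC; congr (_ + _)%E.
Qed.

Lemma smearT r x : 0 < r -> supp mu x -> smear r x setT = 1%E.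
Proof.
move=> r0 sx; rewrite /smear setTI.
have mb0 : (0 < mu (ball x r))%E by apply: sx; [exact: ball_open|exact: ballxx].
have mbf : mu (ball x r) \is a fin_num by apply: mu_fin_num.
rewrite -[X in (_ * X)%E](fineK mbf) -EFinM mulVf//.
by rewrite gt_eqF// fine_gt0// mb0 -ge0_fin_numE.
Qed.

Lemma smear_out r x : smear r x (~` (ball x r : set (BT R k))) = 0%E.
Proof. by rewrite /smear setICl measure0 mule0. Qed.

(** The asymptotic cost per unit mass of passing from [x] to [y] is at most [v]. Asking this for all
    small radii lets finitely many connections share one radius; the slack [e] absorbs the size of
    the balls. *)
Definition conn (x y : Pt R k) (v : R) : Prop := forall e, 0 < e ->
  \forall r \near 0^'+, reach p mu (smear r x) (smear r y) (v + e).

(** The smear around the middle point is dominated by [mu], so it can be borrowed; a Dirac mass at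
    [y] need not be. *)
Lemma conn_trans x y z v w : conn x y v -> conn y z w -> conn x z (v + w).
Proof.
move=> cxy cyz e e0; have e2 : 0 < e / 2 by rewrite divr_gt0.
near=> r.
have rxy : reach p mu (smear r x) (smear r y) (v + e / 2) by near: r; exact: cxy.
have ryz : reach p mu (smear r y) (smear r z) (w + e / 2) by near: r; exact: cyz.
have -> : v + w + e = (v + e / 2) + (w + e / 2) by field.
exact: (reach_trans (dominated_smear r y)) rxy ryz.
Unshelve. all: by end_near. Qed.

Lemma conn_inf x y v : (forall e, 0 < e -> conn x y (v + e)) -> conn x y v.
Proof.
move=> c e e0; have e2 : 0 < e / 2 by rewrite divr_gt0.
apply: filterS (c _ e2 _ e2) => r.
by have -> : v + e / 2 + e / 2 = v + e by field.
Qed.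

Lemma conn_le x y v w : v <= w -> conn x y v -> conn x y w.
Proof.
move=> vw c e e0; apply: filterS (c e e0) => r; apply: reach_le.
by rewrite lerD2r.
Qed.

Lemma conn_jump x y : supp mu x -> supp mu y -> conn x y (eucl x y `^ p).
Proof.
move=> sx sy e e0; near=> r.
have r0 : 0 < r by near: r; exact: nbhs_right_gt.
have H : forall x' y', ball x r x' -> ball y r y' -> eucl x' y' `^ p <= eucl x y `^ p + e.
  by near: r; exact: cost_near.
have [mx mxE] := smear_measure r x; have [my myE] := smear_measure r y.
have mx1 : mx setT = 1%E by rewrite mxE smearT.
have my1 : my setT = 1%E by rewrite myE smearT.
have := @reach_prod R k p mu mx my (ball x r) (ball y r) (eucl x y `^ p + e).
rewrite mx1 my1 /= mulr1 => K.
apply: (reach_ext (al := mx) (be := my)) => //; apply: K => //.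
- exact: ltry.
- by rewrite [LHS]mxE smear_out.
- by rewrite [LHS]myE smear_out.
- by rewrite addr_ge0 ?powR_ge0// ltW.
Unshelve. all: by end_near. Qed.

Lemma conn_refl x : supp mu x -> conn x x 0.
Proof.
move=> sx; have := conn_jump sx sx.
by rewrite eucl_refl powR0 ?gt_eqF.
Qed.

Lemma conn_chain (n : nat) (g : nat -> Pt R k) :
  (forall i, (i <= n)%N -> supp mu (g i)) ->
  conn (g 0) (g n) (\sum_(i < n) eucl (g i) (g i.+1) `^ p).
Proof.
elim: n => [|n IH] H; first by rewrite big_ord0; apply: conn_refl; exact: H.
rewrite big_ord_recr; apply: conn_trans; first by apply: IH => i /leqW; exact: H.
by apply: conn_jump; exact: H.
Qed.

(* [n] jumps of length [L / n] cost [n * (L / n) ^ p], which vanishes since [1 < p]. *)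
Lemma conn_lipschitz (L : R) (g : R -> Pt R k) : 0 < L ->
  (forall s, I01 s -> supp mu (g s)) ->
  (forall s t, I01 s -> I01 t -> eucl (g s) (g t) <= L * `|s - t|) ->
  conn (g 0) (g 1) 0.
Proof.
move=> L0 sg lip; apply: conn_inf => e e0; rewrite add0r.
pose q := p - 1; have q0 : 0 < q by rewrite subr_gt0.
(* [X] solves [X ^ (p - 1) = L ^ p / e]; for [n >= X] the total cost
   [n * (L / n) ^ p = L ^ p / n ^ (p - 1)] is at most [e]. *)
pose X := (L `^ p / e) `^ q^-1.
pose n := (Num.bound X).+1.
have N0 : 0 < n%:R :> R by rewrite ltr0n.
have XN : X <= n%:R.
  apply: ltW; apply: (@lt_le_trans _ _ (Num.bound X)%:R).
    by apply: archi_boundP; exact: powR_ge0.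
  by rewrite ler_nat.
have Xq : X `^ q = L `^ p / e.
  by rewrite /X -powRrM mulVf ?gt_eqF// powRr1// divr_ge0 ?powR_ge0// ltW.
have Nq : L `^ p <= n%:R `^ q * e.
  by rewrite -ler_pdivrMr// -Xq ge0_ler_powR ?nnegrE ?powR_ge0 ?(ltW q0) ?(ltW N0).
have gI i : (i <= n)%N -> I01 (i%:R / n%:R : R).
  by move=> ni; rewrite /I01/= divr_ge0//= ler_pdivrMr// mul1r ler_nat.
have := @conn_chain n (fun i => g (i%:R / n%:R)).
rewrite mul0r divff ?gt_eqF// => /(_ (fun i ni => sg _ (gI i ni))).
apply: conn_le.
apply: (@le_trans _ _ (\sum_(i < n) (L / n%:R) `^ p)).
  apply: ler_sum => i _; apply: ge0_ler_powR; rewrite ?nnegrE ?(ltW p0)//.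
  - exact: sqrtr_ge0.
  - by rewrite divr_ge0// ltW.
  - apply: le_trans (lip _ _ (gI i (ltnW (ltn_ord i))) (gI i.+1 (ltn_ord i))) _.
    rewrite -mulrBl -addn1 natrD opprD addNKr normrM normrN1 mul1r.
    by rewrite ger0_norm// invr_ge0.
rewrite sumr_const card_ord -[leLHS]mulr_natl.
have Nq0 : 0 < n%:R `^ q :> R by rewrite powR_gt0.
rewrite -(ler_pM2r Nq0) [leRHS]mulrC; apply: le_trans Nq.
rewrite mulrAC mulr_powRB1// ?(ltW N0)// mulrC -powRM ?divfK ?gt_eqF//.
by rewrite divr_ge0// ltW.
Qed.

(** Fix a parameter [b], which exists as [beta] has positive mass. The curves [Phi j (s, b)] form a
    chain of Lipschitz paths from [x] to [y], each of asymptotic cost zero. *)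
Lemma conn_component (d : R) (m : {measure set (BT R k) -> \bar R}) x y :
  strongly_connected d m -> supp m `<=` supp mu -> supp m x -> supp m y ->
  conn x y 0.
Proof.
move=> [L [K [N [L0 [K0 [N2 [dD [D [beta [b0 [bfin H]]]]]]]]]]] msub mx my.
have [b] : exists b : D, True.
  apply: contrapT => nD; have : setT = set0 :> set D.
    by apply/seteqP; split=> // z _; case: nD; exists z.
  by move=> T0; move: b0; rewrite T0 measure0 ltxx.
move=> _; have [n [c [Phi [/andP[n1 nN] [c0 [cn [cs HPhi]]]]]]] := H x y mx my.
rewrite -c0 -cn.
have : (n.-1 <= n.-1)%N by [].
move: {1 3}n.-1 => i; elim: i => [|i IH] ni.
  by apply: conn_refl; apply: msub; apply: cs.
have [_ [Ps [Plip _ P01 _]]] := HPhi i ni.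
rewrite -[0]addr0; apply: conn_trans (IH (ltnW ni)) _.
have [<- <-] := P01 b.
apply: (@conn_lipschitz L (fun s => Phi i (s, b))) => //.
- by move=> s Is; apply: msub; exact: Ps.
- by move=> s t; exact: Plip.
Qed.

(** Gathers the mass of [nu] on [K] around the single point [h] at small cost: by compactness [K] is
    cut into finitely many pieces lying in small balls, each piece is spread around the centre of
    its ball, and the centres are connected to [h] for free. *)
Lemma reach_concentrate (nu : {measure set (BT R k) -> \bar R}) (K : set (Pt R k)) h e :
  (nu setT < +oo)%E -> compact K -> measurable (K : set (BT R k)) ->
  K `<=` supp mu -> (forall x, K x -> conn x h 0) -> 0 < e ->
  \forall r \near 0^'+, reach p mu (fun A => nu (A `&` K))
     (fun A => nu K * smear r h A)%E (e * fine (nu K)).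
Proof.
move=> nufin cK mK Ksupp Kh e0.
(* The claim is made for all measurable subsets [B] of some [A'] containing [A]. It is then
   hereditary, and over a union a set [C] splits into the disjoint pieces inside and outside
   [A']. *)
pose P (A : set (Pt R k)) := exists2 A' : set (BT R k), A `<=` A' &
  measurable A' /\ \forall r \near 0^'+,
  forall B : set (BT R k), measurable B -> B `<=` A' ->
  reach p mu (fun A => nu (A `&` B)) (fun A => nu B * smear r h A)%E (e * fine (nu B)).
have fnu B : measurable B -> nu B \is a fin_num by move=> mB; apply: lty_fin_num_fun.
suff [K' KK' [mK' H]] : P K by apply: filterS H => r; apply.
have e2 : 0 < e / 2 by rewrite divr_gt0.
apply: (compact_ind cK).
- exists set0 => //; split; first exact: measurable0.
  apply: nearW => r B mB; rewrite subset0 => ->.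
  rewrite measure0 mulr0; apply: reach_ext (@reach0 _ _ _ _) => A _.
    by rewrite setI0 measure0.
  by rewrite mul0e.
- by move=> A B AB [B' BB' HB]; exists B' => //; exact: subset_trans BB'.
- move=> A B [A' AA' [mA' HA]] [B' BB' [mB' HB]]; exists (A' `|` B').
    exact: setUSS.
  split; first exact: measurableU.
  near=> r => C mC CAB.
  have rA : reach p mu (fun A => nu (A `&` (C `&` A')))
      (fun A => nu (C `&` A') * smear r h A)%E (e * fine (nu (C `&` A'))).
    have HA' := near HA r; apply: HA' => //; exact: measurableI.
  have rB : reach p mu (fun A => nu (A `&` (C `\` A')))
      (fun A => nu (C `\` A') * smear r h A)%E (e * fine (nu (C `\` A'))).
    have HB' := near HB r; apply: HB' => //; first exact: measurableD.
    by move=> z [Cz nz]; case: (CAB z Cz).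
  have mCA : measurable (C `&` A') by exact: measurableI.
  have mCB : measurable (C `\` A') by exact: measurableD.
  have nuC := measureDI nu mC mA'.
  have -> : e * fine (nu C) = e * fine (nu (C `&` A')) + e * fine (nu (C `\` A')).
    by rewrite -mulrDr nuC fineD ?fnu// addrC.
  apply: reach_ext (reachD rA rB) => S mS.
    rewrite (measureDI nu (measurableI _ _ mS mC) mA') addeC -setIA.
    by congr (_ + _)%E; rewrite setIDA.
  rewrite nuC ge0_muleDl// addeC//.
- move=> x Kx.
  (* Half of [e] pays for the move inside the ball around [x], the other half for the connection
     from [x] to [h]. *)
  have [r0 [r0_gt0 Hr0]] : exists r0 : R, 0 < r0 /\ forall x' y',
      ball x r0 x' -> ball x r0 y' -> eucl x' y' `^ p <= e / 2.
    apply: (@filter_ex _ (0^'+)); near=> r; split.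
      by near: r; exact: nbhs_right_gt.
    have -> : e / 2 = eucl x x `^ p + e / 2 by rewrite eucl_refl powR0 ?add0r ?gt_eqF.
    by near: r; exact: cost_near.
  exists (ball x r0); first by split; [exact: ball_open|exact: ballxx].
  exists (ball x r0) => //; split; first exact: ballM.
  near=> r => B mB Bx.
  have r_gt0 : 0 < r by near: r; exact: nbhs_right_gt.
  have rr0 : r <= r0 by near: r; exact: nbhs_right_le.
  have [mx mxE] := smear_measure r x.
  have mx1 : mx setT = 1%E by rewrite mxE smearT//; exact: Ksupp.
  have nB0 : 0 <= fine (nu B) by rewrite fine_ge0.
  pose be : {measure set (BT R k) -> \bar R} := mscale (NngNum nB0) mx.
  have beE A : be A = (nu B * smear r x A)%E.
    by rewrite [LHS](_ : _ = (fine (nu B))%:E * mx A)%E// mxE fineK// fnu.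
  have nuBT : mrestr nu mB setT = nu B by rewrite /mrestr setTI.
  have s1 : reach p mu (fun A => nu (A `&` B)) (fun A => nu B * smear r x A)%E
      (e / 2 * fine (nu B)).
    rewrite -nuBT; apply: reach_ext (@reach_prod _ _ _ _ (mrestr nu mB) be
      B (ball x r) _ _ _ _ _ _ _ _ _) => //.
    + by move=> A mA; rewrite beE nuBT.
    + by rewrite [X in (X < _)%E]nuBT -ge0_fin_numE// fnu.
    + by rewrite [LHS]nuBT [RHS]beE smearT// ?mule1//; exact: Ksupp.
    + by rewrite [LHS](_ : _ = nu (~` B `&` B))// setICl measure0.
    + by rewrite [LHS]beE smear_out mule0.
    + exact: ltW.
    + move=> u v Bu xv; apply: Hr0; first exact: Bx.
      by apply: le_ball xv.
  have s2 : reach p mu (smear r x) (smear r h) (0 + e / 2).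
    by near: r; exact: Kh.
  have := reachZ mu_fin nB0 s2; rewrite fineK ?fnu// => {}s2.
  have -> : e * fine (nu B) = e / 2 * fine (nu B) + fine (nu B) * (0 + e / 2).
    by field.
  apply: reach_trans s1 s2.
  have := dominatedZ nB0 (dominated_smear r x); rewrite fineK ?fnu//.
Unshelve. all: by end_near. Qed.

End Conn.

(** * Upper bound *)

Section Upper.
Variables (R : realType) (k : nat) (p : R) (mu : {measure set (BT R k) -> \bar R}).
Hypothesis p1 : 1 < p.
Hypothesis mu_fin : (mu setT < +oo)%E.
Variables (nup num : {measure set (BT R k) -> \bar R}) (Om : set (Pt R k)).
Hypothesis Om_closed : closed Om.
Hypothesis mu_Om : mu (~` Om) = 0%E.
Hypothesis nup_Om : nup (~` Om) = 0%E.
Hypothesis num_Om : num (~` Om) = 0%E.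

Let p0 : 0 < p. Proof. by apply: lt_trans p1. Qed.

(** The coupling is [e * pi] plus the diagonal image of [mu - e * s]. The stock [e * s] in both
    marginals of [e * pi] restores [mu], and the diagonal part costs nothing. *)
Lemma Wpp_le_reach c : reach p mu nup num c ->
  \forall e \near 0^'+, (Wpp p Om (fun A => mu A + e%:E * nup A)%E
                                  (fun A => mu A + e%:E * num A)%E <= (e * c)%:E)%E.
Proof.
move=> [pi [s [ds pi1 pi2 pic]]]; have [s1 [s2 [C [C0 HC]]]] := ds.
near=> e.
have e0 : 0 < e by near: e; exact: nbhs_right_gt.
have e0' := ltW e0.
have eC : e * C <= 1.
  apply: (@le_trans _ _ (e * (C + 1))); first by rewrite ler_wpM2l// lerDl.
  rewrite -ler_pdivlMr ?ltr_wpDl// mul1r.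
  by near: e; apply: nbhs_right_le; rewrite invr_gt0 ltr_wpDl.
have eC0 : 0 <= 1 - e * C by rewrite subr_ge0.
(* This is [mu - e * s], written without subtraction from [s + s2 = C * mu]; it requires
   [e * C <= 1]. *)
pose rest : {measure set (BT R k) -> \bar R} :=
  measure_add (mscale (NngNum eC0) mu) (mscale (NngNum e0') s2).
have restE A : measurable A -> (rest A + e%:E * s A)%E = mu A.
  move=> mA; have [es eCA] := HC A mA.
  rewrite [X in (X + _)%E](_ : _ = (1 - e * C)%:E * mu A + e%:E * s2 A)%E; last first.
    exact: measure_addE.
  have s0 : (0 <= s A)%E by rewrite -es.
  rewrite -addeA [X in (_ + X)%E]addeC -ge0_muleDr// eCA muleA -EFinM.
  rewrite -ge0_muleDl ?lee_fin ?mulr_ge0//.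
  by rewrite -EFinD subrK mul1e.
have md : measurable_fun setT (fun x : BT R k => (x, x)).
  by apply: measurable_fun_pair.
have [D [DE Dint]] := pushforward_measure rest md.
pose pi' : {measure set (BT R k * BT R k) -> \bar R} :=
  measure_add D (mscale (NngNum e0') pi).
have pi'E A : pi' A = (D A + e%:E * pi A)%E by rewrite [LHS]measure_addE.
have m1 (A : set (BT R k)) : measurable A -> pi' (A `*` setT) = (mu A + e%:E * nup A)%E.
  move=> mA; rewrite pi'E DE pi1// ge0_muleDr ?(dominated_ge0 ds mA)//.
  rewrite (_ : _ @^-1` _ = A); last by apply/seteqP; split=> x //= [].
  by rewrite addeCA (restE _ mA) addeC.
have m2 (A : set (BT R k)) : measurable A -> pi' (setT `*` A) = (mu A + e%:E * num A)%E.
  move=> mA; rewrite pi'E DE pi2// ge0_muleDr ?(dominated_ge0 ds mA)//.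
  rewrite (_ : _ @^-1` _ = A); last by apply/seteqP; split=> x //= [].
  by rewrite addeCA (restE _ mA) addeC.
have mOm : measurable (Om : set (BT R k)) by exact: BT_closed_measurable.
have mOmC : measurable (~` Om : set (BT R k)) by exact: measurableC.
apply: ge_ereal_inf; exists (\int[pi']_z cost p z)%E.
  exists pi'; split=> //; split; last by split.
  apply/eqP; rewrite eq_le measure_ge0 andbT.
  apply: (@le_trans _ _ (pi' ((~` Om) `*` setT `|` setT `*` (~` Om)))).
    rewrite le_measure ?inE//.
    - by apply: measurableC; exact: measurableX.
    - by apply: measurableU; exact: measurableX.
    - move=> [x y] /= nOm; have [Ox|nOx] := pselect (Om x); last by left.
      by right; split=> // Oy; apply: nOm.
  apply: le_trans (measureU2 _ (measurableX mOmC measurableT)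
    (measurableX measurableT mOmC)) _.
  have := m1 _ mOmC; rewrite [mu _]mu_Om [nup _]nup_Om mule0 adde0 => E1.
  have := m2 _ mOmC; rewrite [mu _]mu_Om [num _]num_Om mule0 adde0 => E2.
  by rewrite [X in (X + _)%E]E1 [X in (_ + X)%E]E2 adde0.
rewrite ge0_integral_measure_add//; last 2 first.
- by move=> z _; exact: cost_ge0.
- exact: measurable_cost.
rewrite Dint; [|exact: measurable_cost|exact: cost_ge0].
under eq_integral do rewrite /cost/= eucl_refl powR0 ?gt_eqF//.
rewrite integral0 add0e ge0_integral_mscale//=.
- by rewrite EFinM lee_wpmul2l ?lee_fin.
- exact: measurable_cost.
- by move=> z _; exact: cost_ge0.
Unshelve. all: by end_near. Qed.

Hypothesis Om_compact : compact Om.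
Hypothesis nup_fin : (nup setT < +oo)%E.
Hypothesis num_fin : (num setT < +oo)%E.
Variables (m : nat) (mus : 'I_m -> {measure set (BT R k) -> \bar R}).
Hypothesis mus_disj : forall i j : 'I_m, i != j -> supp (mus i) `&` supp (mus j) = set0.
Hypothesis mus_mu : forall j, supp (mus j) `<=` supp mu.
Hypothesis mus_conn : forall j x y, supp (mus j) x -> supp (mus j) y -> conn p mu x y 0.
Hypothesis mus_Om : forall j, supp (mus j) `<=` Om.
Hypothesis nup_supp : nup (~` \big[setU/set0]_j supp (mus j)) = 0%E.
Hypothesis num_supp : num (~` \big[setU/set0]_j supp (mus j)) = 0%E.

Let E (i j : 'I_m) := Edist p (supp (mus i)) (supp (mus j)).

Lemma Edist_ge0 (X Y : set (Pt R k)) : (0 <= Edist p X Y)%E.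
Proof. by apply/ereal_infP => _ [x Xx [y Yy <-]]; rewrite lee_fin powR_ge0. Qed.

Lemma plen_ge0 n (F : 'I_n -> 'I_n -> \bar R) i s :
  (forall i j, 0 <= F i j)%E -> (0 <= plen F i s)%E.
Proof. by move=> F0; elim: s i => [|j s IH] i //=; exact: adde_ge0. Qed.

Lemma Ebar_ge0 n (F : 'I_n -> 'I_n -> \bar R) i j :
  (forall i j, 0 <= F i j)%E -> (0 <= Ebar F i j)%E.
Proof. by move=> F0; apply/ereal_infP => _ [s _ <-]; exact: plen_ge0. Qed.

(** Moving inside a component is free, so each edge costs only one jump between two points chosen
    nearly optimal for [Edist]. *)
Lemma conn_plen s i x y v : supp (mus i) x -> supp (mus (last i s)) y ->
  (plen E i s <= v%:E)%E -> conn p mu x y v.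
Proof.
elim: s i x v => [|j s IH] i x v /=.
  by move=> ix iy; rewrite lee_fin => v0; apply: conn_le v0 _; exact: mus_conn ix iy.
move=> ix jy.
have := Edist_ge0 (supp (mus i)) (supp (mus j)); rewrite -/(E i j).
have : (0 <= plen E j s)%E by apply: plen_ge0 => ? ?; exact: Edist_ge0.
case Es : (plen E j s) => [b| |] //; case Eij : (E i j) => [a| |] //.
rewrite !lee_fin => b0 a0 abv.
apply: conn_inf => e e0.
have : (E i j < (a + e)%:E)%E by rewrite Eij lte_fin ltrDl.
move=> /ereal_inf_lt[_ [x' ix' [y' jy' <-]]]; rewrite lte_fin => xy.
have c1 := mus_conn ix ix'.
have c2 := conn_jump p1 mu_fin (mus_mu ix') (mus_mu jy').
have c3 : conn p mu y' y b by apply: IH jy' jy _; rewrite Es.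
apply: conn_le _ (conn_trans c1 (conn_trans c2 c3)).
by lra.
Qed.

Lemma conn_Ebar i j x y v : supp (mus i) x -> supp (mus j) y ->
  (Ebar E i j <= v%:E)%E -> conn p mu x y v.
Proof.
move=> ix jy H; apply: conn_inf => e e0.
have : (Ebar E i j < (v + e)%:E)%E by apply: le_lt_trans H _; rewrite lte_fin ltrDl.
move=> /ereal_inf_lt[_ [s /= sj <-]] /ltW; apply: conn_plen => //.
by rewrite sj.
Qed.

(** Gather [nup] around one hub [h j] per component, move mass between hubs according to a nearly
    optimal [lam], and spread the hubs out to [num]. The strict inequality leaves slack for the
    errors. *)
Lemma reach_nunorm v : (nu_norm p (fun j => mus j) nup num < v%:E)%E ->
  reach p mu nup num v.
Proof.
move=> /ereal_inf_lt[_ [lam [lam0 lamr lamc ->]]] lamv.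
pose nb := nubar (fun j => mus j) nup num.
rewrite -/nb in lamr lamc lamv.
pose A_ j : set (BT R k) := supp (mus j).
have mA j : measurable (A_ j) by exact: supp_measurable.
pose P j := fine (nup (A_ j)); pose Q j := fine (num (A_ j)).
have Pf j : nup (A_ j) = (P j)%:E by rewrite fineK// lty_fin_num_fun.
have Qf j : num (A_ j) = (Q j)%:E by rewrite fineK// lty_fin_num_fun.
(* The default [0] is taken only for an empty component; there [nup], [num] and [nb] all vanish. *)
pose h j := xget (0 : Pt R k) (supp (mus j)).
have hA j x : A_ j x -> A_ j (h j) by move=> jx; apply: xgetPex; exists x.
have Ane (nu : {measure set (BT R k) -> \bar R}) j : nu (A_ j) <> 0%E -> exists x, A_ j x.
  move=> nuA; apply: contrapT => nx; apply: nuA.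
  rewrite (_ : A_ j = set0) ?measure0//; apply/seteqP; split=> // x jx.
  by case: nx; exists x.
have nbE j : nb j = P j - Q j by [].
have nbh j : nb j != 0 -> A_ j (h j).
  move=> nbj; have [/eqP P0|/eqP Pn0] := eqVneq (P j) 0.
    have /Ane[x] : num (A_ j) <> 0%E.
      by rewrite Qf => -[Q0]; move: nbj; rewrite nbE Q0 (eqP P0) subrr eqxx.
    exact: hA.
  have /Ane[x] : nup (A_ j) <> 0%E by rewrite Pf => -[].
  exact: hA.
have E0 i j : (0 <= E i j)%E by exact: Edist_ge0.
pose F i j := fine (Ebar E i j).
pose lE i j := ((lam i j)%:E * Ebar E i j)%E.
have lE0 i j : (0 <= lE i j)%E by rewrite mule_ge0 ?lee_fin ?Ebar_ge0.
(* [Ebar] may be infinite where [lam] is zero. The products are finite since their sum lies below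
   [v], so replacing [Ebar] by [F] changes none of them. *)
have lEfin i j : 0 < nb i -> nb j < 0 -> lE i j \is a fin_num.
  move=> bi bj; rewrite ge0_fin_numE//; apply: le_lt_trans (lt_trans lamv (ltry _)).
  apply: (@le_trans _ _ (\sum_(j | (nb j < 0)%R) lE i j)%E).
    by rewrite (bigD1 j)//= leeDl// sume_ge0.
  rewrite [leRHS](bigD1 i)//= leeDl//.
  by apply: sume_ge0 => a _; apply: sume_ge0 => b _; exact: lE0.
have lEF i j : 0 < nb i -> nb j < 0 -> lE i j = (lam i j * F i j)%:E.
  move=> bi bj; have := lEfin i j bi bj; rewrite /lE /F.
  have := Ebar_ge0 i j E0; case: (Ebar E i j) => [a| |]//= _.
  have [->|ln0] := eqVneq (lam i j) 0; first by rewrite mul0e mul0r.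
  by rewrite gt0_muley// lte_fin lt_def ln0 lam0.
pose c := \sum_(i | 0 < nb i) \sum_(j | nb j < 0) lam i j * F i j.
have cv : c < v.
  rewrite -lte_fin; apply: le_lt_trans lamv.
  rewrite /c -sumEFin; apply: lee_sum => i bi.
  by rewrite -sumEFin; apply: lee_sum => j bj; rewrite -lEF.
pose La := \sum_(i | 0 < nb i) \sum_(j | nb j < 0) lam i j.
have La0 : 0 <= La by apply: sumr_ge0 => i _; apply: sumr_ge0.
have P0 j : 0 <= P j by rewrite fine_ge0.
have Q0 j : 0 <= Q j by rewrite fine_ge0.
pose W := \sum_j P j + \sum_j Q j + La + 1.
have W0 : 0 < W by rewrite ltr_wpDl// !addr_ge0// sumr_ge0.
(* Gathering, spreading and moving cause an error of at most [e] per unit of mass, and the masses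
   add up to [W - 1]; the extra [1] keeps [W] positive. *)
pose e := (v - c) / W.
have e0 : 0 < e by rewrite divr_gt0// subr_gt0.
have cA j : compact (A_ j : set (Pt R k)).
  by apply: subclosed_compact Om_compact _ => //; [exact: supp_closed|exact: mus_Om].
have hconn j x : A_ j x -> conn p mu x (h j) 0.
  by move=> jx; apply: (mus_conn jx); exact: hA jx.
suff [r [r1 r2 r3]] : exists r, [/\
    forall j, reach p mu (fun A => nup (A `&` A_ j))
      (fun A => nup (A_ j) * smear mu r (h j) A)%E (e * P j),
    forall j, reach p mu (fun A => num (A `&` A_ j))
      (fun A => num (A_ j) * smear mu r (h j) A)%E (e * Q j) &
    forall i j, 0 < nb i -> nb j < 0 ->
      reach p mu (fun A => (lam i j)%:E * smear mu r (h i) A)%E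
        (fun A => (lam i j)%:E * smear mu r (h j) A)%E (lam i j * (F i j + e))].
  have [SP SPE] : exists SP : set (BT R k) -> \bar R,
      forall A, SP A = (\sum_j nup (A_ j) * smear mu r (h j) A)%E.
    exact: (ex_intro _ _ (fun=> erefl)).
  have [SQ SQE] : exists SQ : set (BT R k) -> \bar R,
      forall A, SQ A = (\sum_j num (A_ j) * smear mu r (h j) A)%E.
    exact: (ex_intro _ _ (fun=> erefl)).
  have [SI SIE] : exists SI : set (BT R k) -> \bar R, forall A, SI A =
      (\sum_(i | (0 < nb i)%R) \sum_(j | (nb j < 0)%R)
        (lam i j)%:E * smear mu r (h i) A)%E.
    exact: (ex_intro _ _ (fun=> erefl)).
  have [SJ SJE] : exists SJ : set (BT R k) -> \bar R, forall A, SJ A =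
      (\sum_(i | (0 < nb i)%R) \sum_(j | (nb j < 0)%R)
        (lam i j)%:E * smear mu r (h j) A)%E.
    exact: (ex_intro _ _ (fun=> erefl)).
  have s1 : reach p mu nup SP (\sum_j e * P j).
    apply: reach_ext (reach_sum (index_enum 'I_m) (P := xpredT) (fun j _ => r1 j)) => A AM.
      by rewrite -(measure_partition (m := nup) (F := A_)).
    by rewrite SPE.
  have s2 : reach p mu SQ num (\sum_j e * Q j).
    apply: reach_sym.
    apply: reach_ext (reach_sum (index_enum 'I_m) (P := xpredT) (fun j _ => r2 j)) => A AM.
      by rewrite -(measure_partition (m := num) (F := A_)).
    by rewrite SQE.
  have s3 : reach p mu SI SJ
      (\sum_(i | 0 < nb i) \sum_(j | nb j < 0) lam i j * (F i j + e)).
    apply: reach_ext (reach_sum (index_enum 'I_m) (fun i (bi : 0 < nb i) =>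
      reach_sum (index_enum 'I_m) (fun j (bj : nb j < 0) => r3 i j bi bj))) => A _.
      by rewrite SIE.
    by rewrite SJE.
  have dQ : dominated mu SQ.
    apply: (@dominated_ext _ _ _ _ _ (fun A _ => esym (SQE A))).
    apply: dominated_sum => j _; rewrite Qf.
    by apply: dominatedZ => //; exact: dominated_smear.
  have dI : dominated mu SI.
    apply: (@dominated_ext _ _ _ _ _ (fun A _ => esym (SIE A))).
    apply: dominated_sum => i _; apply: dominated_sum => j _.
    by apply: dominatedZ => //; exact: dominated_smear.
  apply: (reach_le (c := \sum_j e * P j + (\sum_j e * Q j +
     \sum_(i | 0 < nb i) \sum_(j | nb j < 0) lam i j * (F i j + e)))).
    rewrite -!mulr_sumr.
    have -> : \sum_(i | 0 < nb i) \sum_(j | nb j < 0) lam i j * (F i j + e) = c + e * La.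
      rewrite /c /La mulr_sumr -big_split; apply: eq_bigr => i _.
      rewrite mulr_sumr -big_split; apply: eq_bigr => j _.
      by rewrite /= mulrDr [e * _]mulrC.
    have -> : v = c + e * W by rewrite /e divfK ?gt_eqF// addrC subrK.
    by rewrite /W; have := ltW e0; lra.
  (* The three transports together send [nup + SQ + SI] to [SP + num + SJ]. Cancelling [SQ + SI]
     needs [SP + SJ = SQ + SI], which holds hub by hub: [P j - Q j = nb j] is the net mass that
     [lam] takes out of [h j]. *)
  apply: (reach_cancel (dominatedD dQ dI)).
  apply: reach_ext (reachD s1 (reachD s2 s3)) => A AM //.
  rewrite addeCA; congr (_ + _)%E.
  pose g j := fine (smear mu r (h j) A).
  have gE j : smear mu r (h j) A = (g j)%:E.
    by rewrite fineK//; exact: (dominated_fin mu_fin (dominated_smear mu r (h j)) AM).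
  have -> : SP A = (\sum_j P j * g j)%:E.
    by rewrite SPE -sumEFin; apply: eq_bigr => j _; rewrite Pf gE EFinM.
  have -> : SQ A = (\sum_j Q j * g j)%:E.
    by rewrite SQE -sumEFin; apply: eq_bigr => j _; rewrite Qf gE EFinM.
  have -> : SI A = (\sum_(i | 0 < nb i) nb i * g i)%:E.
    rewrite SIE -sumEFin; apply: eq_bigr => i bi.
    rewrite -[in RHS](lamr i bi) mulr_suml -sumEFin; apply: eq_bigr => j _.
    by rewrite gE EFinM.
  have -> : SJ A = (\sum_(j | nb j < 0) - nb j * g j)%:E.
    rewrite SJE exchange_big /= -sumEFin; apply: eq_bigr => j bj.
    rewrite -(lamc j bj) mulr_suml -sumEFin; apply: eq_bigr => i _.
    by rewrite gE EFinM.
  rewrite -!EFinD; congr (_%:E).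
  rewrite [X in _ + X = _]big_mkcond [X in _ = _ + X]big_mkcond -!big_split.
  apply: eq_bigr => j _ /=; rewrite nbE.
  case: ltgtP => H; rewrite ?addr0; [by ring|by ring|].
  by move/eqP: H; rewrite subr_eq0 => /eqP ->.
(* Finitely many conditions, each valid for all small radii, hold at a common radius. *)
apply: (@filter_ex _ (0^'+)); near=> r; split.
- near: r; apply: filter_forall => j.
  apply: reach_concentrate => //; first exact: mus_mu.
  by move=> x; exact: hconn.
- near: r; apply: filter_forall => j.
  apply: reach_concentrate => //; first exact: mus_mu.
  by move=> x; exact: hconn.
- near: r; apply: filter_forall => i; apply: filter_forall => j.
  have [bi|nbi] := boolP (0 < nb i); last by apply: nearW.
  have [bj|nbj] := boolP (nb j < 0); last by apply: nearW.
  have [->|ln0] := eqVneq (lam i j) 0.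
    apply: nearW => r _ _; rewrite mul0r.
    by apply: reach_ext (@reach0 _ _ _ _) => A _; rewrite mul0e.
  have : conn p mu (h i) (h j) (F i j).
    apply: (@conn_Ebar i j); [by apply: nbh; rewrite gt_eqF|by apply: nbh; rewrite lt_eqF|].
    have := lEfin i j bi bj; rewrite /lE /F.
    have := Ebar_ge0 i j E0; case: (Ebar E i j) => [a| |]//= _.
    by rewrite gt0_muley// lte_fin lt_def ln0 lam0.
  move=> /(_ e e0); apply: filterS => r rr _ _.
  exact: reachZ.
Unshelve. all: by end_near. Qed.

End Upper.

(** * Lower bound *)

Section Ebar.
Variables (R : realType) (n : nat) (F : 'I_n -> 'I_n -> \bar R).
Hypothesis F0 : forall i j, (0 <= F i j)%E.

Lemma plen_cat i s t : plen F i (s ++ t) = (plen F i s + plen F (last i s) t)%E.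
Proof. by elim: s i => [|j s IH] i /=; rewrite ?add0e// IH addeA. Qed.

Lemma Ebar_le i j : (Ebar F i j <= F i j)%E.
Proof. by apply: ge_ereal_inf; exists (plen F i [:: j]); [exists [:: j]|rewrite /= adde0]. Qed.

Lemma Ebar_triangle i v j : (Ebar F i j <= Ebar F i v + Ebar F v j)%E.
Proof.
have := Ebar_ge0 i v F0; have := Ebar_ge0 v j F0.
case Evj : (Ebar F v j) => [b| |]// _; case Eiv : (Ebar F i v) => [a| |]// _;
  rewrite ?addey ?addye ?leey//.
apply/lee_addgt0Pr => e e0.
have e2 : 0 < e / 2 by rewrite divr_gt0.
have : (Ebar F i v < (a + e / 2)%:E)%E by rewrite Eiv lte_fin ltrDl.
move=> /ereal_inf_lt[_ [s /= sv <-]] /ltW sa.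
have : (Ebar F v j < (b + e / 2)%:E)%E by rewrite Evj lte_fin ltrDl.
move=> /ereal_inf_lt[_ [t /= tj <-]] /ltW tb.
apply: ge_ereal_inf; exists (plen F i (s ++ t)).
  by exists (s ++ t) => //=; rewrite last_cat sv.
rewrite plen_cat sv; apply: le_trans (leeD sa tb) _.
by rewrite -!EFinD lee_fin; lra.
Qed.

End Ebar.

(** * Couplings as flows between components *)

Section Lower.
Variables (R : realType) (k : nat) (p : R) (mu : {measure set (BT R k) -> \bar R}).
Hypothesis mu_fin : (mu setT < +oo)%E.
Variables (nup num : {measure set (BT R k) -> \bar R}).
Hypothesis nup_fin : (nup setT < +oo)%E.
Hypothesis num_fin : (num setT < +oo)%E.
Variables (m : nat) (mus : 'I_m -> {measure set (BT R k) -> \bar R}).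
Hypothesis mus_disj : forall i j : 'I_m, i != j -> supp (mus i) `&` supp (mus j) = set0.
Hypothesis mu_supp : mu (~` \big[setU/set0]_j supp (mus j)) = 0%E.
Hypothesis nup_supp : nup (~` \big[setU/set0]_j supp (mus j)) = 0%E.
Hypothesis num_supp : num (~` \big[setU/set0]_j supp (mus j)) = 0%E.

Let E (i j : 'I_m) := Edist p (supp (mus i)) (supp (mus j)).

(** The edge lengths [E] need not satisfy the triangle inequality, but [Ebar] does and lies below
    [E]. So [flow_to_transport] applies to [Ebar], and dividing its plan by [e] gives a competitor
    for [nunorm]. *)
Lemma nunorm_le_flow (nb : 'I_m -> R) (e : R) (q : 'I_m -> 'I_m -> R) :
  0 < e -> (forall i j, 0 <= q i j) ->
  (forall i, \sum_j q i j - \sum_j q j i = e * nb i) ->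
  (forall i, nb i != 0 -> supp (mus i) !=set0) ->
  (e%:E * nunorm nb (Ebar E) <= \sum_i \sum_j (q i j)%:E * E i j)%E.
Proof.
move=> e0 q0 qdiv ne.
have E0 i j : (0 <= E i j)%E by exact: Edist_ge0.
have Eb0 i j : (0 <= Ebar E i j)%E by exact: Ebar_ge0.
(* [Ebar] is infinite at empty components: truncate it at [M]. *)
pose M := \sum_i \sum_j fine (Ebar E i j).
have M0 : 0 <= M by apply: sumr_ge0 => i _; apply: sumr_ge0 => j _; exact: fine_ge0.
pose d i j := fine (Order.min (Ebar E i j) M%:E).
have dE i j : (d i j)%:E = Order.min (Ebar E i j) M%:E.
  rewrite fineK// ge0_fin_numE; first by rewrite gt_min ltry orbT.
  by rewrite le_min Eb0 lee_fin.
have d0 i j : 0 <= d i j by rewrite -lee_fin dE le_min Eb0 lee_fin.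
have dtri i v j : d i j <= d i v + d v j.
  rewrite -lee_fin EFinD !dE.
  have [iv|/ltW iv] := leP (Ebar E i v) M%:E; last first.
    by apply: (@le_trans _ _ M%:E); rewrite ?ge_min ?lexx ?orbT// leeDl// -dE lee_fin.
  have [vj|/ltW vj] := leP (Ebar E v j) M%:E; last first.
    by apply: (@le_trans _ _ M%:E); rewrite ?ge_min ?lexx ?orbT// leeDr.
  by rewrite ge_min Ebar_triangle.
have [l [l0 lrow lcol lcost]] := flow_to_transport dtri d0 q0 qdiv.
have bpos i : (0 < e * nb i) = (0 < nb i) by rewrite pmulr_rgt0.
have bneg i : (e * nb i < 0) = (nb i < 0) by rewrite pmulr_rlt0.
have {}lcost : \sum_(i | 0 < nb i) \sum_(j | nb j < 0) l i j * d i j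
    <= \sum_i \sum_j q i j * d i j.
  by move: lcost; rewrite (eq_bigl _ _ bpos); under eq_bigr do rewrite (eq_bigl _ _ bneg).
(* Between nonempty components [Ebar] is finite, and as one of the nonnegative terms summed in [M]
   it is not affected by the truncation. *)
have dEb i j : nb i != 0 -> nb j != 0 -> (Ebar E i j = (d i j)%:E)%E.
  move=> /ne[x ix] /ne[y jy].
  have : (Ebar E i j < +oo)%E.
    apply: le_lt_trans (Ebar_le _ _ _) (le_lt_trans _ (ltry (eucl x y `^ p))).
    by apply: ge_ereal_inf; exists (eucl x y `^ p)%:E => //; exists x => //; exists y.
  rewrite -ge0_fin_numE// => Ef; rewrite dE min_l// -(fineK Ef) lee_fin.
  rewrite /M (bigD1 i)//= (bigD1 j)//= -addrA lerDl addr_ge0//.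
    by apply: sumr_ge0 => a _; exact: fine_ge0.
  by apply: sumr_ge0 => a _; apply: sumr_ge0 => b _; exact: fine_ge0.
have H : (nunorm nb (Ebar E) <= (e^-1 * \sum_i \sum_j q i j * d i j)%:E)%E.
  apply: ge_ereal_inf.
  exists (\sum_(i | (0 < nb i)%R) \sum_(j | (nb j < 0)%R) (e^-1 * l i j)%:E * Ebar E i j)%E.
    exists (fun i j => e^-1 * l i j); split=> //.
    - by move=> i j; rewrite mulr_ge0// invr_ge0 ltW.
    - move=> i nbi; rewrite -mulr_sumr -(eq_bigl _ _ bneg).
      by rewrite lrow ?bpos// mulKf// gt_eqF.
    - move=> j nbj; rewrite -mulr_sumr -(eq_bigl _ _ bpos).
      by rewrite lcol ?bneg// mulrN mulKf// gt_eqF.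
  have -> : (\sum_(i | (0 < nb i)%R) \sum_(j | (nb j < 0)%R) (e^-1 * l i j)%:E * Ebar E i j)%E
     = (e^-1 * \sum_(i | 0 < nb i) \sum_(j | nb j < 0) l i j * d i j)%:E.
    rewrite mulr_sumr -sumEFin; apply: eq_bigr => i nbi.
    rewrite mulr_sumr -sumEFin; apply: eq_bigr => j nbj.
    by rewrite (dEb _ _ (lt0r_neq0 nbi) (ltr0_neq0 nbj)) -EFinM mulrA.
  by rewrite lee_fin ler_pM2l ?invr_gt0.
apply: (@le_trans _ _ (e%:E * (e^-1 * \sum_i \sum_j q i j * d i j)%:E)%E).
  by rewrite lee_wpmul2l// lee_fin ltW.
rewrite -EFinM mulrA divff ?gt_eqF// mul1r -sumEFin; apply: lee_sum => i _.
rewrite -sumEFin; apply: lee_sum => j _.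
rewrite EFinM lee_wpmul2l ?lee_fin// dE.
by apply: le_trans (Ebar_le _ _ _); rewrite ge_min lexx.
Qed.

(** Row and column sums of [q] are the marginals on the components; in their difference [mu]
    cancels, leaving [e * nubar]. On each product of two components the cost is at least [Edist]. *)
Lemma nunorm_le_coupling Om e (pi : {measure set (BT R k * BT R k) -> \bar R}) :
  0 < e -> is_coupling Om (fun A => mu A + e%:E * nup A)%E
     (fun A => mu A + e%:E * num A)%E pi ->
  (e%:E * nu_norm p (fun j => mus j) nup num <= \int[pi]_z cost p z)%E.
Proof.
move=> e0 [_ [pi1 pi2]].
pose A_ j : set (BT R k) := supp (mus j).
have mA j : measurable (A_ j) by exact: supp_measurable.
pose q i j := fine (pi (A_ i `*` A_ j)).
have pifin : (pi setT < +oo)%E.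
  by rewrite -setXTT pi1// lte_add_pinfty// lte_mul_pinfty// ?lee_fin ?ltW.
have qE i j : (q i j)%:E = pi (A_ i `*` A_ j).
  by rewrite fineK// lty_fin_num_fun//; exact: measurableX.
have mC : measurable (~` \big[setU/set0]_j A_ j).
  by apply: measurableC; exact: bigsetU_measurable.
have row i : (\sum_j (q i j)%:E = mu (A_ i) + e%:E * nup (A_ i))%E.
  rewrite -pi1// (@measure_partition _ _ _ _ pi (fun j => setT `*` A_ j) (A_ i `*` setT)).
  - by apply: eq_bigr => j _; rewrite qE -setXI setTI setIT.
  - by move=> j; exact: measurableX.
  - by move=> j1 j2 j12; rewrite -setXI [_ `&` A_ _]mus_disj// setX0.
  (* Outside the strips [pi] has no mass, because its second marginal vanishes off the
     components. *)
  - rewrite (_ : ~` _ = setT `*` (~` \big[setU/set0]_j A_ j)).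
      have := pi2 _ mC; rewrite [mu _]mu_supp [num _]num_supp mule0 adde0; exact.
    have -> : \big[setU/set0]_j (setT `*` A_ j) = setT `*` \big[setU/set0]_j A_ j
        :> set (BT R k * BT R k).
      rewrite (@big_morph _ _ (fun B => setT `*` B : set (BT R k * BT R k))
        set0 setU set0 setU) //.
        by move=> B C; rewrite predeqE => -[x y]; rewrite /setX /setU /=; tauto.
      exact: setX0.
    by apply/seteqP; split=> -[x y] /= H; [split=> // yA; apply: H|case=> _ yA; apply: H.2].
  - exact: measurableX.
have col i : (\sum_j (q j i)%:E = mu (A_ i) + e%:E * num (A_ i))%E.
  rewrite -pi2// (@measure_partition _ _ _ _ pi (fun j => A_ j `*` setT) (setT `*` A_ i)).
  - by apply: eq_bigr => j _; rewrite qE -setXI setTI setIT.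
  - by move=> j; exact: measurableX.
  - by move=> j1 j2 j12; rewrite -setXI [_ `&` A_ _]mus_disj// set0X.
  - rewrite (_ : ~` _ = (~` \big[setU/set0]_j A_ j) `*` setT).
      have := pi1 _ mC; rewrite [mu _]mu_supp [nup _]nup_supp mule0 adde0; exact.
    have -> : \big[setU/set0]_j (A_ j `*` setT) = \big[setU/set0]_j A_ j `*` setT
        :> set (BT R k * BT R k).
      rewrite (@big_morph _ _ (fun B => B `*` setT : set (BT R k * BT R k))
        set0 setU set0 setU) //.
        by move=> B C; rewrite predeqE => -[x y]; rewrite /setX /setU /=; tauto.
      exact: set0X.
    by apply/seteqP; split=> -[x y] /= H; [split=> // yA; apply: H|case=> yA _; apply: H.1].
  - exact: measurableX.
have fA (nu : {measure set (BT R k) -> \bar R}) j :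
    (nu setT < +oo)%E -> nu (A_ j) = (fine (nu (A_ j)))%:E.
  by move=> nuf; rewrite fineK// lty_fin_num_fun.
apply: (@le_trans _ _ (\sum_i \sum_j (q i j)%:E * E i j)%E).
  apply: nunorm_le_flow => //.
  - by move=> i j; rewrite fine_ge0.
  - move=> i; have := row i; have := col i.
    rewrite !sumEFin (fA mu)// (fA nup)// (fA num)// -!EFinM -!EFinD => -[->] [->].
    by rewrite /nubar; lra.
  - move=> i nbi; apply: contrapT => /nonemptyPn A0.
    by move: nbi; rewrite /nubar A0 !measure0 subrr eqxx.
pose FF (z : 'I_m * 'I_m) := A_ z.1 `*` A_ z.2.
have mFF z : measurable (FF z) by exact: measurableX.
rewrite pair_big /=.
apply: (@le_trans _ _ (\int[pi]_(z in
    \big[setU/set0]_(i <- index_enum ('I_m * 'I_m)%type) FF i) cost p z)%E);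
  last first.
  apply: ge0_subset_integral => //.
  - exact: bigsetU_measurable.
  - exact: measurable_cost.
  - by move=> z _; exact: cost_ge0.
rewrite ge0_integral_bigsetU//; last first.
- by move=> z _; exact: cost_ge0.
- by apply: measurable_funTS; exact: measurable_cost.
- apply/trivIsetP => -[i j] [i' j'] _ _ /=; rewrite xpair_eqE negb_and => /orP[]ij.
    by rewrite /FF -setXI [_ `&` A_ _]mus_disj// set0X.
  by rewrite /FF -setXI [X in _ `*` X]mus_disj// setX0.
- exact: index_enum_uniq.
apply: lee_sum => -[i j] _ /=.
rewrite qE muleC -integral_cst//; last exact: mFF (i, j).
apply: ge0_le_integral => //.
- exact: mFF (i, j).
- by move=> z _; exact: Edist_ge0.
- by apply: measurable_funTS; exact: measurable_cost.
- move=> [x y] [/= ix jy]; apply: ge_ereal_inf; exists (cost p (x, y)) => //.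
  by exists x => //; exists y.
Qed.

End Lower.

(** * Rescaling *)

(** A squeeze: [w e / e] is at least [N] and, for each [v > N], eventually at most [v]. The factor
    [e ^ (-1/p)] cancels the [p]-th root of [e]. *)
Lemma cvg_poweR_rescaled (R : realType) (p : R) (w : R -> \bar R) (N : \bar R) :
  0 < p -> (0 <= N)%E -> (forall e, 0 < e -> (e%:E * N <= w e)%E) ->
  (forall v, (N < v%:E)%E -> \forall e \near 0^'+, (w e <= (e * v)%:E)%E) ->
  (fun e : R => ((e `^ (- p^-1))%:E * poweR (w e) p^-1)%E) @ 0^'+ --> poweR N p^-1.
Proof.
move=> p0 N0 lower upper.
have pi0 : 0 < p^-1 by rewrite invr_gt0.
have pin0 : p^-1 != 0 by rewrite gt_eqF.
(* For infinite [N] the lower bound alone forces [w e = +oo], so the rescaled function is constant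
   near zero. *)
case: N N0 lower upper => [n| |]// N0 lower upper; last first.
  apply: cvg_near_cst; near=> e.
  have e0 : 0 < e by near: e; exact: nbhs_right_gt.
  have -> : w e = +oo%E.
    by apply/eqP; rewrite -leye_eq; apply: le_trans (lower e e0); rewrite gt0_muley.
  by rewrite poweRyr// gt0_muley// lte_fin powR_gt0.
rewrite lee_fin in N0.
rewrite poweR_EFin.
pose L := n `^ p^-1.
have L0 : 0 <= L by exact: powR_ge0.
have bounds (v : R) : n < v -> \forall e \near 0^'+,
    exists2 y, ((e `^ (- p^-1))%:E * poweR (w e) p^-1)%E = y%:E & L <= y <= v `^ p^-1.
  move=> nv; near=> e.
  have e0 : 0 < e by near: e; exact: nbhs_right_gt.
  have : (w e <= (e * v)%:E)%E by near: e; apply: upper; rewrite lte_fin.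
  have := lower e e0; case: (w e) => [x| |]//; rewrite -EFinM !lee_fin => nx xv.
  have x0 : 0 <= x by apply: le_trans nx; rewrite mulr_ge0// ltW.
  have v0 : 0 <= v by apply: le_trans (ltW nv).
  have scale y : 0 <= y -> e `^ (- p^-1) * (e * y) `^ p^-1 = y `^ p^-1.
    by move=> y0; rewrite powRM ?(ltW e0)// powRN mulKf// gt_eqF// powR_gt0.
  exists (e `^ (- p^-1) * x `^ p^-1); first by rewrite poweR_EFin EFinM.
  rewrite /L -(scale n N0) -(scale v v0) !ler_wpM2l ?powR_ge0//.
    by rewrite ge0_ler_powR ?nnegrE ?(ltW pi0)// mulr_ge0// ltW.
  by rewrite ge0_ler_powR ?nnegrE ?(ltW pi0)// mulr_ge0// ltW.
apply/fine_cvgP; split.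
  have n1 : n < n + 1 by rewrite ltrDl.
  by apply: filterS (bounds _ n1) => e [y -> _].
apply/cvgrPdist_le => eps eps0.
(* The value [v = (L + eps) ^ p] is chosen so that the upper bound [v ^ (1/p)] is exactly
   [L + eps]. *)
have nv : n < (L + eps) `^ p.
  have <- : L `^ p = n by rewrite /L -powRrM mulVf ?gt_eqF// powRr1.
  by rewrite gt0_ltr_powR ?nnegrE ?addr_ge0 ?ltrDl// ltW.
apply: filterS (bounds _ nv) => e [y /= -> /=].
rewrite -powRrM divff ?gt_eqF// powRr1 ?addr_ge0 ?(ltW eps0)// => /andP[Ly yL].
by rewrite -/L distrC ger0_norm ?subr_ge0// lerBlDl.
Unshelve. all: by end_near. Qed.

(** * Assembling the two bounds *)

Theorem theorem3 (R : realType) (k m : nat) (p : R) (Om : set (Pt R k))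
    (mu : {measure set (BT R k) -> \bar R})
    (mus : 'I_m -> {measure set (BT R k) -> \bar R}) (d : 'I_m -> R)
    (nup num : {measure set (BT R k) -> \bar R}) :
  1 < p ->
  compact Om -> closure (interior Om) = Om ->
  mu setT = 1%E -> mu (~` Om) = 0%E ->
  (2 <= m)%N ->
  (forall A : set (BT R k), measurable A -> mu A = (\sum_(j < m) mus j A)%E) ->
  (forall i j : 'I_m, i != j -> supp (mus i) `&` supp (mus j) = set0) ->
  (forall j, 1 <= d j /\ strongly_connected (d j) (mus j)) ->
  (nup setT < +oo)%E -> (num setT < +oo)%E -> nup setT = num setT ->
  nup (~` Om) = 0%E -> num (~` Om) = 0%E ->
  supp nup `|` supp num `<=` supp mu ->
  (fun eps : R => ((eps `^ (- p^-1))%:E *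
      Wp p Om (fun A => mu A + eps%:E * nup A)%E
              (fun A => mu A + eps%:E * num A)%E)%E)
    @ 0^'+ --> poweR (nu_norm p (fun j => mus j) nup num) p^-1.
Proof.
move=> p1 cOm clOm mu1 muOm _ mu_sum disj sconn nup_fin num_fin _ nupOm numOm supp_nu.
have p0 : 0 < p by exact: lt_trans p1.
have Om_closed : closed Om by rewrite -clOm; exact: closed_closure.
have mu_fin : (mu setT < +oo)%E by rewrite mu1 ltry.
have mOmC : measurable (~` Om : set (BT R k)).
  by apply: measurableC; exact: BT_closed_measurable.
have mus_le j A : measurable A -> (mus j A <= mu A)%E.
  by move=> mA; rewrite mu_sum// (bigD1 j)//= leeDl// sume_ge0.
have mus_mu j : supp (mus j) `<=` supp mu.
  move=> x xj U oU Ux; apply: lt_le_trans (xj U oU Ux) (mus_le _ _ _).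
  exact: BT_open_measurable.
have mus0 j : mus j (~` Om) = 0%E.
  by apply/eqP; rewrite eq_le measure_ge0 andbT -muOm mus_le.
have mus_Om j : supp (mus j) `<=` Om by exact: supp_subset.
pose S := \big[setU/set0]_j supp (mus j).
have S_closed : closed S by apply: closed_bigsetU => j _; exact: supp_closed.
have jS j : supp (mus j) `<=` S by rewrite /S (bigD1 j)//=; exact: subsetUl.
have mSC : measurable (~` S : set (BT R k)).
  by apply: measurableC; exact: BT_closed_measurable.
have mu_S : mu (~` S) = 0%E.
  rewrite mu_sum// big1// => j _; apply/eqP; rewrite eq_le measure_ge0 andbT.
  rewrite -(supp_null cOm Om_closed (mus0 j)) le_measure// ?inE//.
    by apply: measurableC; exact: supp_measurable.
  by apply: subsetC; exact: jS.
have suppS : supp mu `<=` S by exact: supp_subset.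
(* The hypotheses compare supports only; [supp_null] turns this into the absence of mass off the
   components, which both bounds use. *)
have null_S (nu : {measure set (BT R k) -> \bar R}) :
    nu (~` Om) = 0%E -> supp nu `<=` supp mu -> nu (~` S) = 0%E.
  move=> nuOm numu; apply/eqP; rewrite eq_le measure_ge0 andbT.
  rewrite -(supp_null cOm Om_closed nuOm) le_measure// ?inE//.
    by apply: measurableC; exact: supp_measurable.
  by apply: subsetC; exact: subset_trans suppS.
have nup_S : nup (~` S) = 0%E by apply: null_S => // x nx; apply: supp_nu; left.
have num_S : num (~` S) = 0%E by apply: null_S => // x nx; apply: supp_nu; right.
apply: cvg_poweR_rescaled => //.
- apply/ereal_infP => _ [lam [lam0 _ _ ->]].
  apply: sume_ge0 => i _; apply: sume_ge0 => j _.
  by rewrite mule_ge0 ?lee_fin// Ebar_ge0// => a b; exact: Edist_ge0.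
- move=> e e0; apply/ereal_infP => _ [pi [cpi ->]].
  exact: nunorm_le_coupling cpi.
- move=> v /reach_nunorm => reach_v.
  apply: Wpp_le_reach => //; apply: (reach_v mu p1 mu_fin Om cOm) => //.
  by move=> j x y; have [_ sc] := sconn j; exact: conn_component sc _.
Qed.
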